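(* Let $p$ be a pure stable polynomial on $\mathbb{H}^2$ with $p(0,0)=0$, with local Puiseux factorization data $q_j,L_j,M_j$ ($j=1,\dots,k$) as in the context. Define the product ideal of $R_0=\mathbb{C}\{z_1,z_2\}$ $$\mathcal{I}=\prod_{j=1}^{k}(z_2+q_j(z_1),\,z_1^{2L_j})^{M_j}R_0$$ and the polynomial $[p](z)=\prod_{j=1}^{k}(z_2+q_j(z_1)+iz_1^{2L_j})^{M_j}$. Let $f\in\mathbb{C}[z_1,z_2]$. Then: (1) If $f\in\mathcal{I}$, then $f/p$ is locally $H^\infty$. (2) $f/p$ is locally $H^\infty$ if and only if $f/[p]$ is locally $H^\infty$. (3) Suppose $p$ has either a double point at $(0,0)$, an ordinary multiple point at $(0,0)$, or repeated segments at $(0,0)$. If $f/p$ is locally $H^\infty$, then $f\in\mathcal{I}$.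
   Context: $\mathbb{H}$ is the open upper half plane and $\bar p(z)=\overline{p(\bar z_1,\bar z_2)}$. A polynomial $p\in\mathbb{C}[z_1,z_2]$ is pure stable if it has no zeros in $\mathbb{H}^2$ and no nonconstant factor in common with $\bar p$. $R_0=\mathbb{C}\{z_1,z_2\}$ is the ring of convergent power series at $(0,0)$. It is known that a pure stable $p$ vanishing at $(0,0)$ factors near $(0,0)$ as $$p(z)=u(z)\prod_{j=1}^{k}\prod_{m=1}^{M_j}\left(z_2+q_j(z_1)+z_1^{2L_j}\psi_j(\mu_j^mz_1^{1/M_j})\right),$$ where $u\in R_0$ is a unit, for each $j$ the inner product over $m$ is an irreducible Weierstrass polynomial in $z_2$ of degree $M_j$, $L_j$ is a positive integer, $\mu_j=e^{2\pi i/M_j}$, $q_j\in\mathbb{R}[z_1]$, $q_j(0)=0$, $q_j'(0)>0$, $\deg q_j<2L_j$, and $\psi_j\in\mathbb{C}\{t\}$ with $\operatorname{Im}\psi_j(0)>0$ (the product over $m$ does not depend on the choice of $M_j$-th root of $z_1$). $(g,h)^{N}$ is the $N$-th power of the ideal generated by $g$ and $h$, and $\prod$ is the product of ideals. A function is locally $H^\infty$ if it is analytic and bounded on the intersection of $\mathbb{H}^2$ with some neighborhood of $(0,0)$ in $\mathbb{C}^2$. $p$ has a double point at $(0,0)$ if it vanishes to order exactly $2$ there; an ordinary multiple point if it vanishes to order $M$ and has $M$ distinct tangents (its lowest order homogeneous term is a product of $M$ pairwise non-proportional linear forms); repeated segments if all the polynomials $q_j$ are the same (the cutoffs $2L_j$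 may differ). *)

(* Defs.v *)
From HB Require Import structures.
From mathcomp Require Import all_boot all_order all_algebra.
From mathcomp Require Import complex.
From mathcomp Require Import all_classical all_reals all_analysis.

Set Implicit Arguments.
Unset Strict Implicit.
Unset Printing Implicit Defensive.

Import Order.TTheory GRing.Theory Num.Theory numFieldNormedType.Exports.

Local Open Scope ring_scope.
Local Open Scope classical_set_scope.
Local Open Scope complex_scope.

(* The norm topology on R[i]; mathcomp-analysis only attaches it to abstract
   numFieldTypes. *)
HB.instance Definition _ (R : rcfType) :=
  NormedModule.copy R[i] (R[i] : numFieldType).

Definition fps (A : Type) : Type := nat -> A.

Section FormalPowerSeries.
Variable A : comNzRingType.
Implicit Types a b c : fps A.

HB.instance Definition _ := GRing.Zmodule.copy (fps A) (nat -> A).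

Definition fps_one : fps A := fun n => (n == 0%N)%:R.
Definition fps_mul a b : fps A := fun n => \sum_(i < n.+1) a i * b (n - i)%N.

Let trunc n a : {poly A} := \poly_(i < n.+1) a i.

Let coef_trunc n a i : (i <= n)%N -> (trunc n a)`_i = a i.
Proof. by move=> le_in; rewrite coef_poly ltnS le_in. Qed.

Let coef_truncM n a b m :
  (m <= n)%N -> fps_mul a b m = (trunc n a * trunc n b)`_m.
Proof.
move=> le_mn; rewrite coefM; apply: eq_bigr => i _.
by rewrite !coef_trunc // (leq_trans _ le_mn) ?leq_subr // -ltnS.
Qed.

Fact fps_mulA : associative fps_mul.
Proof.
move=> a b c; apply/funext => n.
transitivity ((trunc n a * (trunc n b * trunc n c))`_n).
  rewrite coefM; apply: eq_bigr => i _.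
  by rewrite coef_trunc -1?ltnS // -coef_truncM ?leq_subr.
rewrite mulrA coefM; apply: eq_bigr => i _.
by rewrite -coef_truncM -1?ltnS // coef_trunc ?leq_subr.
Qed.

Fact fps_mulC : commutative fps_mul.
Proof.
by move=> a b; apply/funext => n; rewrite !(@coef_truncM n) // mulrC.
Qed.

Fact fps_mul1 : left_id fps_one fps_mul.
Proof.
move=> a; apply/funext => n; rewrite /fps_mul big_ord_recl /= mul1r subn0.
by rewrite big1 ?addr0 // => i _; rewrite mul0r.
Qed.

Fact fps_mulDl : left_distributive fps_mul +%R.
Proof.
move=> a b c; apply/funext => n.
by rewrite /GRing.add /= -big_split; apply: eq_bigr => i _; rewrite mulrDl.
Qed.

Fact fps_one_neq0 : fps_one != 0.
Proof. by apply/eqP => /(congr1 (@^~ 0%N)) /eqP; rewrite oner_eq0. Qed.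

HB.instance Definition _ := GRing.Zmodule_isComNzRing.Build (fps A)
  fps_mulA fps_mulC fps_mul1 fps_mulDl fps_one_neq0.

End FormalPowerSeries.

Section ConvergentPowerSeries.
Variable R : realType.
Implicit Types (t : R[i]) (z : R[i] * R[i]).

(* Absolute convergence on some (poly)disc: the partial sums of the norms are
   bounded at some positive radius. *)
Definition convergent1 (a : fps R[i]) : Prop :=
  exists r B : R[i], 0 < r /\
    forall N, \sum_(i < N) `|a i| * r ^+ i <= B.

(* [a i j] is the coefficient of z_1^i z_2^j. *)
Definition convergent2 : {pred fps (fps R[i])} := fun a =>
  `[< exists r B : R[i], 0 < r /\
      forall N, \sum_(i < N) \sum_(j < N) `|a i j| * r ^+ (i + j) <= B >].

Let min_pos (r s : R[i]) : 0 < r -> 0 < s ->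
  exists2 t : R[i], 0 < t & (t <= r) /\ (t <= s).
Proof.
move=> r0 s0; case: (real_leP (gtr0_real r0) (gtr0_real s0)) => [rs|/ltW sr].
- by exists r.
- by exists s.
Qed.

Let radius_le (a : fps (fps R[i])) (r s B : R[i]) : 0 < r -> r <= s ->
  (forall N, \sum_(i < N) \sum_(j < N) `|a i j| * s ^+ (i + j) <= B) ->
  forall N, \sum_(i < N) \sum_(j < N) `|a i j| * r ^+ (i + j) <= B.
Proof.
move=> r0 rs aB N; apply: le_trans (aB N).
apply: ler_sum => i _; apply: ler_sum => j _.
by rewrite ler_wpM2l // lerXn2r // nnegrE ?(ltW r0) // (le_trans (ltW r0)).
Qed.

Let fps2_mulE (a b : fps (fps R[i])) i j :
  (a * b) i j = \sum_(k < i.+1) \sum_(l < j.+1) a k l * b (i - k)%N (j - l)%N.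
Proof.
have sumE n (F : 'I_n -> fps R[i]) m : (\sum_k F k) m = \sum_k F k m.
  by elim/big_rec2: _ => // k x y _ <-.
by rewrite [LHS]sumE.
Qed.

Let conv_le (u v : nat -> R[i]) N :
  (forall n, 0 <= u n) -> (forall n, 0 <= v n) ->
  \sum_(i < N) \sum_(k < i.+1) u k * v (i - k)%N
    <= (\sum_(i < N) u i) * \sum_(i < N) v i.
Proof.
move=> u0 v0.
under eq_bigr => i _ do
  rewrite (big_ord_widen N (fun k => u k * v (i - k)%N)) ?ltn_ord //.
rewrite (exchange_big_dep xpredT) //= mulr_suml; apply: ler_sum => k _.
rewrite -mulr_sumr ler_wpM2l //.
rewrite -(big_geq_mkord k N xpredT (fun i => v (i - k)%N)).
rewrite -{1}[nat_of_ord k]add0n big_addn.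
under eq_bigr => i _ do rewrite addnK.
rewrite -[leRHS](big_mkord xpredT v) [leRHS](big_cat_nat (n := N - k)) ?leq_subr //=.
by rewrite lerDl sumr_ge0.
Qed.

Fact convergent2_subring : subring_closed convergent2.
Proof.
split=> [|a b /asboolP[ra [A [ra0 aA]]] /asboolP[rb [B [rb0 bB]]]
         |a b /asboolP[ra [A [ra0 aA]]] /asboolP[rb [B [rb0 bB]]]].
- apply/asboolP; exists 1, 1; split=> // -[|N]; first by rewrite big_ord0 ler01.
  rewrite big_ord_recl big_ord_recl [X in _ + X + _]big1 => [|j _]; last first.
    by rewrite normr0 mul0r.
  rewrite [X in _ + X]big1 => [|i _]; last first.
    by rewrite big1 // => j _; rewrite normr0 mul0r.
  by rewrite normr1 expr1n mulr1 !addr0.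
- have [r r0 [/radius_le/(_ aA) aA' /radius_le/(_ bB) bB']] := min_pos ra0 rb0.
  apply/asboolP; exists r, (A + B); split=> // N.
  apply: le_trans (lerD (aA' r0 N) (bB' r0 N)).
  rewrite -big_split; apply: ler_sum => i _; rewrite -big_split.
  apply: ler_sum => j _ /=; rewrite -mulrDl ler_wpM2r ?exprn_ge0 ?(ltW r0) //.
  exact: ler_normB.
- have [r r0 [/radius_le/(_ aA) aA' /radius_le/(_ bB) bB']] := min_pos ra0 rb0.
  have {}aA := aA' r0; have {}bB := bB' r0.
  pose P i j := `|a i j| * r ^+ (i + j); pose Q i j := `|b i j| * r ^+ (i + j).
  have P0 i j : 0 <= P i j by rewrite mulr_ge0 ?exprn_ge0 ?(ltW r0).
  have Q0 i j : 0 <= Q i j by rewrite mulr_ge0 ?exprn_ge0 ?(ltW r0).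
  apply/asboolP; exists r, (A * B); split=> // N.
  have sP0 : 0 <= \sum_(i < N) \sum_(j < N) P i j.
    by rewrite sumr_ge0 // => i _; rewrite sumr_ge0.
  have sQ0 : 0 <= \sum_(i < N) \sum_(j < N) Q i j.
    by rewrite sumr_ge0 // => i _; rewrite sumr_ge0.
  apply: le_trans (ler_pM sP0 sQ0 (aA N) (bB N)).
  apply: le_trans (conv_le N (u := fun i => \sum_(j < N) P i j)
    (v := fun i => \sum_(j < N) Q i j) _ _); last 2 first.
  - by move=> i; rewrite sumr_ge0.
  - by move=> i; rewrite sumr_ge0.
  apply: ler_sum => i _.
  apply: (@le_trans _ _ (\sum_(j < N) \sum_(k < i.+1) \sum_(l < j.+1)
      P k l * Q (i - k)%N (j - l)%N)); last first.
    rewrite exchange_big; apply: ler_sum => k _.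
    exact: (conv_le N (P0 k) (Q0 (i - k)%N)).
  apply: ler_sum => j _; rewrite fps2_mulE.
  apply: le_trans (ler_wpM2r _ (ler_norm_sum _ _ _)) _.
    by rewrite exprn_ge0 // ltW.
  rewrite mulr_suml; apply: ler_sum => k _.
  apply: le_trans (ler_wpM2r _ (ler_norm_sum _ _ _)) _.
    by rewrite exprn_ge0 // ltW.
  rewrite mulr_suml; apply: ler_sum => l _.
  rewrite normrM /P /Q mulrACA -exprD addnACA !subnKC ?lexx // -ltnS //.
Qed.

HB.instance Definition _ :=
  GRing.isSubringClosed.Build (fps (fps R[i])) convergent2 convergent2_subring.

Record R0 := MkR0 { series_of :> fps (fps R[i]); _ : series_of \in convergent2 }.

HB.instance Definition _ := [isSub for series_of].
HB.instance Definition _ := [Choice of R0 by <:].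
HB.instance Definition _ := [SubChoice_isSubComNzRing of R0 by <:].

Definition eval1 (a : fps R[i]) t : R[i] :=
  limn (fun N : nat => \sum_(i < N) a i * t ^+ i).

Definition eval2 (a : R0) z : R[i] :=
  limn (fun N : nat => \sum_(i < N) \sum_(j < N) series_of a i j * z.1 ^+ i * z.2 ^+ j).

(* C[z_1, z_2] is {poly {poly R[i]}} with z_2 as the outer indeterminate. *)
Definition peval (p : {poly {poly R[i]}}) z : R[i] := p.[z.2%:P].[z.1].

Fact convergent2_poly (p : {poly {poly R[i]}}) :
  (fun i j => p`_j`_i) \in convergent2.
Proof.
pose D := maxn (size p) (\max_(j < size p) size (p`_j)%R).
have p0 i j : (D <= i)%N || (D <= j)%N -> p`_j`_i = 0.
  rewrite !geq_max => /orP[/andP[_ Di]|/andP[Dj _]]; last first.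
    by rewrite [p`_j]nth_default // coef0.
  have [jp|pj] := ltnP j (size p); last by rewrite [p`_j]nth_default // coef0.
  rewrite nth_default // (leq_trans _ Di) //.
  exact: (leq_bigmax (F := fun j : 'I_(size p) => size (p`_j)%R) (Ordinal jp)).
have sumD n (F : nat -> R[i]) : (forall i, 0 <= F i) ->
    (forall i, (D <= i)%N -> F i = 0) -> \sum_(i < n) F i <= \sum_(i < D) F i.
  move=> F0 FD; have [nD|/ltnW Dn] := leqP n D.
    by rewrite (big_ord_widen D F nD) [leRHS](bigID (fun i : 'I_D => (i < n)%N)) /=
               lerDl sumr_ge0.
  rewrite (big_ord_widen n F Dn) (bigID (fun i : 'I_n => (i < D)%N)) /=.
  by rewrite [X in _ + X]big1 ?addr0 // => i; rewrite -leqNgt => /FD.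
apply/asboolP; exists 1, (\sum_(i < D) \sum_(j < D) `|p`_j`_i|).
split=> // N.
under eq_bigr => i _ do under eq_bigr => j _ do rewrite expr1n mulr1.
apply: (@le_trans _ _ (\sum_(i < N) \sum_(j < D) `|p`_j`_i|)).
  apply: ler_sum => i _; apply: (sumD N (fun j => `|p`_j`_i|)) => // j Dj.
  by rewrite p0 ?Dj ?orbT // normr0.
apply: (sumD N (fun i => \sum_(j < D) `|p`_j`_i|)) => [i|i Di].
  by rewrite sumr_ge0.
by rewrite big1 // => j _; rewrite p0 ?Di // normr0.
Qed.

Definition R0_of_poly (p : {poly {poly R[i]}}) : R0 :=
  MkR0 (convergent2_poly p).

End ConvergentPowerSeries.

Section Ideals.
Variable A : comNzRingType.

Definition is_unit (x : A) : Prop := exists y, x * y = 1.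

Definition irreducible_elt (x : A) : Prop :=
  ~ is_unit x /\ forall a b, x = a * b -> is_unit a \/ is_unit b.

Definition ideal2 (g h : A) : set A :=
  [set x | exists a b, x = a * g + b * h].

Definition ideal_mul (I J : set A) : set A :=
  [set x | exists n (a b : 'I_n -> A),
     (forall i, I (a i) /\ J (b i)) /\ x = \sum_i a i * b i].

Definition ideal_exp (I : set A) (n : nat) : set A :=
  iter n (ideal_mul I) setT.

End Ideals.

Section Theory.
Variable R : realType.
Implicit Types (p f : {poly {poly R[i]}}) (z : R[i] * R[i]) (q : {poly R}).

Definition H2 : set (R[i] * R[i]) :=
  [set z | 0 < complex.Im z.1 /\ 0 < complex.Im z.2].

(* p-bar(z) = conj (p (conj z)) has the conjugate coefficients. *)
Definition poly_bar p : {poly {poly R[i]}} := map_poly (map_poly (@conjc R)) p.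

Definition pure_stable p : Prop :=
  (forall z, H2 z -> peval p z <> 0) /\
  (forall d e e', p = d * e -> poly_bar p = d * e' ->
     exists c : R[i], d = c%:P%:P).

Definition analytic_at (F : R[i] * R[i] -> R[i]) z : Prop :=
  exists g : R0 R, \forall h \near ((0, 0) : R[i] * R[i]),
    F (z.1 + h.1, z.2 + h.2) = eval2 g h.

Definition locally_Hinf (F : R[i] * R[i] -> R[i]) : Prop :=
  exists U : set (R[i] * R[i]), [/\ open_nbhs (0, 0) U,
    forall z, (U `&` H2) z -> analytic_at F z &
    exists B : R[i], forall z, (U `&` H2) z -> `|F z| <= B].

Definition weierstrass (w : R0 R) (d : nat) : Prop :=
  [/\ forall i, series_of w i d = (i == 0%N)%:R,
      forall i j, (d < j)%N -> series_of w i j = 0 &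
      forall j, (j < d)%N -> series_of w 0%N j = 0].

(* e^(2 pi i / M) *)
Definition root_mu (M : nat) : R[i] :=
  cos (2 * pi / M%:R) +i* sin (2 * pi / M%:R).

Definition real_to_complex_poly q : {poly R[i]} := map_poly (real_complex R) q.

(* The product over the branches of z_1^(1/M), [t] being one M-th root of z_1. *)
Definition branch_prod (M L : nat) q (psi : fps R[i]) z (t : R[i]) : R[i] :=
  \prod_(1 <= m < M.+1)
    (z.2 + (real_to_complex_poly q).[z.1]
     + z.1 ^+ (2 * L) * eval1 psi (root_mu M ^+ m * t)).

Record puiseux_data p (k : nat) (M L : 'I_k -> nat) (q : 'I_k -> {poly R})
    (psi : 'I_k -> fps R[i]) : Prop := {
  puiseux_M_gt0 : forall j, (0 < M j)%N;
  puiseux_L_gt0 : forall j, (0 < L j)%N;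
  puiseux_q0 : forall j, (q j).[0] = 0;
  puiseux_dq0 : forall j, 0 < (q j)^`().[0];
  puiseux_size_q : forall j, (size (q j) <= 2 * L j)%N;
  puiseux_psi : forall j, convergent1 (psi j);
  puiseux_psi0 : forall j, 0 < complex.Im (psi j 0%N);
  puiseux_irreducible : forall j, exists w : R0 R,
    [/\ weierstrass w (M j), irreducible_elt w &
        \forall z \near ((0, 0) : R[i] * R[i]),
          forall t, t ^+ M j = z.1 ->
            eval2 w z = branch_prod (M j) (L j) (q j) (psi j) z t];
  puiseux_factorization : exists2 u : R0 R, is_unit u &
    \forall z \near ((0, 0) : R[i] * R[i]),
      forall t : 'I_k -> R[i], (forall j, t j ^+ M j = z.1) ->
        peval p z = eval2 u z
          * \prod_(j < k) branch_prod (M j) (L j) (q j) (psi j) z (t j) }.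

Definition segment q : {poly {poly R[i]}} :=
  'X + (real_to_complex_poly q)%:P.

Definition product_ideal (k : nat) (M L : 'I_k -> nat) (q : 'I_k -> {poly R}) :
    set (R0 R) :=
  \big[@ideal_mul (R0 R)/setT]_(j < k)
    ideal_exp (ideal2 (R0_of_poly (segment (q j)))
                      (R0_of_poly ('X^(2 * L j))%:P)) (M j).

(* The polynomial written [p]. *)
Definition bracket (k : nat) (M L : 'I_k -> nat) (q : 'I_k -> {poly R}) :
    {poly {poly R[i]}} :=
  \prod_(j < k) (segment (q j) + ('i *: 'X^(2 * L j))%:P) ^+ M j.

Definition vanishes_to_order p (n : nat) : Prop :=
  (forall i j, (i + j < n)%N -> p`_j`_i = 0) /\
  (exists i j, (i + j = n)%N /\ p`_j`_i <> 0).

Definition homogeneous_part p (n : nat) : {poly {poly R[i]}} :=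
  \sum_(i < n.+1) (p`_(n - i)`_i *: 'X^i)%:P * 'X^(n - i).

Definition linear_form (a b : R[i]) : {poly {poly R[i]}} :=
  (a *: 'X)%:P + b%:P%:P * 'X.

Definition double_point p : Prop := vanishes_to_order p 2.

Definition ordinary_multiple_point p : Prop :=
  exists n : nat, vanishes_to_order p n /\
  exists a b : 'I_n -> R[i],
    homogeneous_part p n = \prod_(i < n) linear_form (a i) (b i) /\
    forall i j, i != j -> forall c : R[i],
      linear_form (a i) (b i) <> c%:P%:P * linear_form (a j) (b j).

Definition repeated_segments (k : nat) (q : 'I_k -> {poly R}) : Prop :=
  forall j j', q j = q j'.

End Theory.

(* Main.v *)
(* On H^2 near the origin Im(z2 + q(z1) + z1^(2L) psi) is at least a positive
   multiple of |z1|^(2L), because z1^(2L) differs from |z1|^(2L) by at most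
   2L |z1| Im z1, which is absorbed by Im q(z1).  So replacing psi by i changes
   each factor of p by a bounded ratio, |p| and |[p]| are comparable, and both
   (1) and (2) follow from estimates of moduli.

   For (3), letting z tend to real points gives
   |f(x,y)| <= K prod_j (|y + q_j(x)| + x^(2L_j))^(M_j).  If the q_j agree modulo
   z1^(2L_j) with one q, the ideal is monomial in (z1, z2 + q(z1)), and testing f
   on the curves y + q(x) = l x^e, for all l and e, kills every monomial outside
   it.  If all M_j are 1 and the contact orders of the q_j do not exceed the
   cutoffs, testing on y = - q_j(x) gives the order of f on each segment; after
   subtracting suitable multiples of z1^(2L_j) prod_(i<>j) (z2 + q_i), f vanishes
   on all segments, hence is a multiple of prod_j (z2 + q_j).  Double points and
   ordinary multiple points reduce to these two situations by comparing the
   lowest order terms of p and [p]. *)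

Require Import Defs.
From HB Require Import structures.
From mathcomp Require Import all_boot all_order all_algebra.
From mathcomp Require Import complex.
From mathcomp Require Import all_classical all_reals all_analysis.
From mathcomp Require Import zify ring lra.

Set Implicit Arguments.
Unset Strict Implicit.
Unset Printing Implicit Defensive.

Import Order.TTheory GRing.Theory Num.Theory numFieldNormedType.Exports.
Import Normc.

Local Open Scope ring_scope.
Local Open Scope classical_set_scope.

(** * Convergent power series and their values *)

(** Quotients are handled through the preorder [dom], |F| <= K |G| on H^2 near the origin. The
    denominators do not vanish there, so analyticity is automatic and boundedness is domination.
    Only moduli enter, so the branches can be evaluated at any pointwise choice of roots of z1,
    continuous or not. In the monomial case, with w = z2 + q, the coefficient of z1^a w^b survives
    the tests on w = l x^e only if sum_j M_j min(e, 2 L_j) <= a + e b for every e >= 1. That these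
    inequalities put z1^a w^b into the ideal is combinatorics: each of the M_j copies of factor j is
    assigned z1^(2 L_j) or w, within the budgets a and b. In the separated case, interpolation along
    the segments divides by the differences q_i - q_j, which are powers of z1 times polynomials
    nonzero at 0. These polynomials are units of R0 but not of C[z1, z2], so the argument is run on
    the product of f with such a unit. *)

Section ComplexNorm.
Variable R : rcfType.
Local Notation C := R[i].
Implicit Types z w : C.

Lemma norm_normc z : `|z| = (normc z)%:C%C. Proof. by []. Qed.
Lemma normc_ge0 z : 0 <= normc z.
Proof. by case: z => a b; exact: sqrtr_ge0. Qed.
Lemma normcD z w : normc (z + w) <= normc z + normc w.
Proof. exact: le_normcD. Qed.
Lemma normcB z w : normc (z - w) = normc (w - z).
Proof. by rewrite -(normcN (z - w)) opprB. Qed.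
Lemma normcX z n : normc (z ^+ n) = normc z ^+ n.
Proof. by elim: n => [|n IH]; rewrite ?expr0 ?normc1 // !exprS normcM IH. Qed.
Lemma normc_sum (I : Type) (r : seq I) (P : pred I) (F : I -> C) :
  normc (\sum_(i <- r | P i) F i) <= \sum_(i <- r | P i) normc (F i).
Proof.
elim/big_rec2: _ => [|i x y _ le_xy]; first by rewrite normc0.
by apply: le_trans (normcD _ _) _; rewrite lerD2l.
Qed.
Lemma normc_prod (I : Type) (r : seq I) (P : pred I) (F : I -> C) :
  normc (\prod_(i <- r | P i) F i) = \prod_(i <- r | P i) normc (F i).
Proof. by elim/big_rec2: _ => [|i x y _ <-]; rewrite ?normc1 ?normcM. Qed.
Lemma normc_real (x : R) : normc x%:C%C = `|x|.
Proof. by rewrite /normc /= expr0n /= addr0 sqrtr_sqr. Qed.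
Lemma normc_eq0 z : (normc z == 0) = (z == 0).
Proof. by apply/eqP/eqP => [/eq0_normc|->]; rewrite ?normc0. Qed.
Lemma normc_gt0 z : (0 < normc z) = (z != 0).
Proof. by rewrite lt_def normc_ge0 normc_eq0 andbT. Qed.
Lemma Re_le_normc z : `|complex.Re z| <= normc z.
Proof.
case: z => a b /=; rewrite -(@sqrtr_sqr R a); apply: ler_wsqrtr.
by rewrite lerDl sqr_ge0.
Qed.
Lemma Im_le_normc z : `|complex.Im z| <= normc z.
Proof.
case: z => a b /=; rewrite -(@sqrtr_sqr R b); apply: ler_wsqrtr.
by rewrite lerDr sqr_ge0.
Qed.
Lemma normc_le_ReIm z : normc z <= `|complex.Re z| + `|complex.Im z|.
Proof.
rewrite {1}(complexE z); apply: le_trans (normcD _ _) _.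
rewrite normcM !normc_real lerD2l.
suff -> : normc 'i%C = 1 :> R by rewrite mul1r.
by rewrite /normc /= expr0n expr1n /= add0r sqrtr1.
Qed.
End ComplexNorm.

Section GeometricLimits.
Variable R : realType.
Local Notation C := R[i].

(** The fixed ratio 1/2 is enough because series are evaluated on bidiscs of half a radius at which
    they are bounded. *)
Lemma limn_geomE (S : nat -> C) l (K : R) :
  (forall N, normc (S N - l) <= K * 2^-1 ^+ N) -> limn S = l.
Proof.
move=> SK; apply: cvg_lim; first exact: norm_hausdorff.
apply/cvgrPdist_lt => e e0.
have er : e \is Num.real by exact: gtr0_real.
have e0' : 0 < complex.Re e by move: e0; rewrite ltcE => /andP[_].
have := @cvg_geometric R K 2^-1.
rewrite ger0_norm ?invr_ge0 // invf_lt1 // => /(_ (ltr1n _ 2)).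
move/cvgrPdist_lt/(_ _ e0'); apply: filterS => N /=.
rewrite sub0r normrN /geometric /= => geN.
rewrite norm_normc -(RRe_real er) ltcR normcB.
exact: le_lt_trans (SK N) (le_lt_trans (ler_norm _) geN).
Qed.

(* The limit is the supremum of the lower bounds S N - e N. *)
Lemma real_geometric_lim (S : nat -> R) (e : nat -> R) :
  (forall N M, (N <= M)%N -> `|S M - S N| <= e N) ->
  {homo e : m n / (m <= n)%N >-> n <= m} ->
  exists l, forall N, `|S N - l| <= e N.
Proof.
move=> Se ne; pose E := [set S N - e N | N in [set: nat]].
have SE N M : S M - e M <= S N + e N.
  case: (leqP N M) => [NM|/ltnW MN].
    have := Se _ _ NM; have := Se _ _ (leqnn M); rewrite !ler_norml; lra.
  have := Se _ _ MN; have := Se _ _ (leqnn N); rewrite !ler_norml; lra.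
have hE : has_sup E.
  split; first by exists (S 0%N - e 0%N), 0%N.
  by exists (S 0%N + e 0%N) => _ [M _ <-].
exists (sup E) => N; rewrite ler_norml; apply/andP; split.
  rewrite lerBrDr addrC lerBlDr; apply: ge_sup; first by case: hE.
  by move=> _ [M _ <-].
rewrite lerBlDl -lerBlDr; apply: sup_upper_bound => //; first by exists N.
Qed.

(** Real and imaginary parts converge separately, whence the factor 2. The ratio rho is kept in the
    error, although 1/2 would give convergence, so that [eval1_near] can read off a bound linear in
    |t| at N = 1. *)
Lemma limn_geom (S : nat -> C) (K rho : R) : 0 <= rho <= 2^-1 ->
  (forall N M, (N <= M)%N -> normc (S M - S N) <= K * rho ^+ N) ->
  (forall N, normc (S N - limn S) <= 2 * K * rho ^+ N).
Proof.
move=> /andP[r0 r2] SK.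
have K0 : 0 <= K.
  by have := le_trans (normc_ge0 _) (SK 0%N 0%N (leqnn _)); rewrite expr0 mulr1.
have ne : {homo (fun N => K * rho ^+ N) : m n / (m <= n)%N >-> n <= m}.
  move=> m n mn; rewrite ler_wpM2l // -(subnK mn) exprD ler_piMl ?exprn_ge0 //.
  rewrite exprn_ile1 //; lra.
have [a aP] : exists a, forall N, `|complex.Re (S N) - a| <= K * rho ^+ N.
  apply: real_geometric_lim ne => N M NM; apply: le_trans (SK N M NM).
  by apply: le_trans (Re_le_normc _); case: (S M) (S N) => ? ? [].
have [b bP] : exists b, forall N, `|complex.Im (S N) - b| <= K * rho ^+ N.
  apply: real_geometric_lim ne => N M NM; apply: le_trans (SK N M NM).
  by apply: le_trans (Im_le_normc _); case: (S M) (S N) => ? ? [].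
have SK2 N : normc (S N - (a +i* b)%C) <= 2 * K * rho ^+ N.
  apply: le_trans (normc_le_ReIm _) _.
  have := aP N; have := bP N; case: (S N) => c d /=; lra.
suff -> : limn S = (a +i* b)%C by [].
apply: (@limn_geomE _ _ (2 * K)) => N; apply: le_trans (SK2 N) _.
by apply: ler_wpM2l; [rewrite mulr_ge0|rewrite lerXn2r // nnegrE invr_ge0].
Qed.

End GeometricLimits.

Section BoxSums.
Variable V : zmodType.

Lemma sum_ord_widen n N (F : nat -> V) : (n <= N)%N ->
  \sum_(i < n) F i = \sum_(i < N) if (i < n)%N then F i else 0.
Proof. by move=> nN; rewrite (big_ord_widen N F nN) big_mkcond. Qed.

Lemma box_diff (T : nat -> nat -> V) N M : (N <= M)%N ->
  \sum_(i < M) \sum_(j < M) T i j - \sum_(i < N) \sum_(j < N) T i j =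
  \sum_(i < M) \sum_(j < M) if (i < N)%N && (j < N)%N then 0 else T i j.
Proof.
move=> NM; rewrite (sum_ord_widen (fun i => \sum_(j < N) T i j) NM) -sumrB.
apply: eq_bigr => i _; case: ifP => iN /=; last by rewrite subr0.
rewrite (sum_ord_widen (T i) NM) -sumrB; apply: eq_bigr => j _.
by case: ifP => _; rewrite ?subrr ?subr0.
Qed.

Lemma conv_sum (f : nat -> nat -> V) N :
  \sum_(i < N) \sum_(k < i.+1) f k (i - k)%N =
  \sum_(k < N) \sum_(l < N) if (k + l < N)%N then f k l else 0.
Proof.
under eq_bigr => i _ do
  rewrite (big_ord_widen N (fun k => f k (i - k)%N)) ?ltn_ord //.
rewrite (exchange_big_dep xpredT) //=; apply: eq_bigr => k _.
rewrite -(big_geq_mkord k N xpredT (fun i => f k (i - k)%N)).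
rewrite -{1}[nat_of_ord k]add0n big_addn big_mkord.
transitivity (\sum_(l < N - k) f k l); first by apply: eq_bigr => l _; rewrite addnK.
rewrite (sum_ord_widen (f k) (leq_subr k N)).
by apply: eq_bigr => l _; rewrite ltn_subRL.
Qed.

Lemma conv_sum2 (F : nat -> nat -> nat -> nat -> V) N :
  \sum_(i < N) \sum_(j < N) \sum_(k < i.+1) \sum_(m < j.+1)
     F k m (i - k)%N (j - m)%N =
  \sum_(k < N) \sum_(l < N) \sum_(m < N) \sum_(n < N)
     if (k + l < N)%N && (m + n < N)%N then F k m l n else 0.
Proof.
under eq_bigr => i _ do rewrite exchange_big /=.
rewrite (conv_sum (fun k l => \sum_(j < N) \sum_(m < j.+1) F k m l (j - m)%N)).
apply: eq_bigr => k _; apply: eq_bigr => l _; case: ifP => _ /=.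
  exact: (conv_sum (fun m n => F k m l n)).
by rewrite big1 // => m _; rewrite big1.
Qed.
End BoxSums.

Lemma mul_box_sums (A : comNzRingType) (P Q : nat -> nat -> A) N :
  (\sum_(k < N) \sum_(m < N) P k m) * (\sum_(l < N) \sum_(n < N) Q l n) =
  \sum_(k < N) \sum_(l < N) \sum_(m < N) \sum_(n < N) P k m * Q l n.
Proof.
rewrite big_distrlr /=; apply: eq_bigr => k _; apply: eq_bigr => l _.
by rewrite big_distrlr.
Qed.

Lemma fps_sumE (A : comNzRingType) (I : Type) (r : seq I) (P : pred I)
  (F : I -> fps A) m : (\sum_(i <- r | P i) F i) m = \sum_(i <- r | P i) F i m.
Proof. by elim/big_rec2: _ => // k x y _ <-. Qed.

Lemma fps_mulE (A : comNzRingType) (a b : fps A) n :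
  (a * b) n = \sum_(i < n.+1) a i * b (n - i)%N.
Proof. by []. Qed.

Lemma fps2_mulE (A : comNzRingType) (a b : fps (fps A)) i j : (a * b) i j =
  \sum_(k < i.+1) \sum_(m < j.+1) a k m * b (i - k)%N (j - m)%N.
Proof. by rewrite fps_mulE fps_sumE. Qed.

Section Evaluation.
Variable R : realType.
Local Notation C := R[i].
Implicit Types (a b : fps (fps C)) (z : C * C).

Definition bound2 a (r A : R) := forall N,
  \sum_(i < N) \sum_(j < N) normc (a i j) * r ^+ (i + j) <= A.

Lemma convergent2P a :
  a \in @convergent2 R <-> exists r A : R, 0 < r /\ bound2 a r A.
Proof.
split=> [/asboolP[r [B [r0 aB]]]|[r [A [r0 aA]]]].
  (* In the order of R[i] a positive element is real; the sum for N = 0 shows that B is real too. *)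
  have rr : (complex.Re r)%:C%C = r by apply: RRe_real; exact: gtr0_real.
  have r0' : 0 < complex.Re r by rewrite -ltcR rr.
  have Br : (complex.Re B)%:C%C = B.
    by apply: RRe_real; apply: ger0_real; have := aB 0%N; rewrite big_ord0.
  exists (complex.Re r), (complex.Re B); split=> // N.
  rewrite -lecR Br; apply: le_trans (aB N); rewrite le_eqVlt; apply/orP; left.
  rewrite rmorph_sum; apply/eqP; apply: eq_bigr => i _; rewrite rmorph_sum.
  by apply: eq_bigr => j _; rewrite /= rmorphM rmorphXn /= rr.
apply/asboolP; exists r%:C%C, A%:C%C; split; first by rewrite ltcR.
move=> N; move: (aA N); rewrite -lecR; apply: le_trans.
rewrite le_eqVlt; apply/orP; left.
rewrite rmorph_sum; apply/eqP; apply: eq_bigr => i _; rewrite rmorph_sum.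
by apply: eq_bigr => j _; rewrite /= rmorphM rmorphXn.
Qed.

Definition psum a z N := \sum_(i < N) \sum_(j < N) a i j * z.1 ^+ i * z.2 ^+ j.

Lemma bound2_ge0 a r A : bound2 a r A -> 0 <= A.
Proof. by move/(_ 0%N); rewrite big_ord0. Qed.

Lemma normc_term (c : C) z (r rho : R) i j : 0 <= rho * r ->
  normc z.1 <= rho * r -> normc z.2 <= rho * r ->
  normc (c * z.1 ^+ i * z.2 ^+ j) <= normc c * r ^+ (i + j) * rho ^+ (i + j).
Proof.
move=> r0 z1 z2; rewrite !normcM !normcX -!mulrA ler_wpM2l ?normc_ge0 //.
rewrite -exprMn [r * _]mulrC exprD.
by apply: ler_pM; rewrite ?exprn_ge0 ?normc_ge0 // lerXn2r ?nnegrE ?normc_ge0.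
Qed.

Lemma expr_anti (rho : R) m n : 0 <= rho <= 1 -> (m <= n)%N ->
  rho ^+ n <= rho ^+ m.
Proof.
move=> /andP[r0 r1] mn.
by rewrite -(subnK mn) exprD ler_piMl ?exprn_ge0 // exprn_ile1.
Qed.

Lemma psum_diff a z r A rho : bound2 a r A -> 0 <= r -> 0 <= rho <= 1 ->
  normc z.1 <= rho * r -> normc z.2 <= rho * r ->
  forall N M, (N <= M)%N -> normc (psum a z M - psum a z N) <= A * rho ^+ N.
Proof.
move=> aA r0 rho01 z1 z2 N M NM; have /andP[rho0 rho1] := rho01.
have rr : 0 <= rho * r by rewrite mulr_ge0.
rewrite /psum (box_diff (fun i j => a i j * z.1 ^+ i * z.2 ^+ j) NM).
apply: le_trans (normc_sum _ _ _) _.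
apply: le_trans (ler_wpM2r _ (aA M)); last by rewrite exprn_ge0.
rewrite mulr_suml; apply: ler_sum => i _; apply: le_trans (normc_sum _ _ _) _.
rewrite mulr_suml; apply: ler_sum => j _; case: ifP => [|/negbT ij].
  by rewrite normc0 !mulr_ge0 ?normc_ge0 ?exprn_ge0.
apply: le_trans (normc_term _ _ _ rr z1 z2) _.
rewrite ler_wpM2l ?mulr_ge0 ?normc_ge0 ?exprn_ge0 // expr_anti //.
by move: ij; rewrite negb_and -!leqNgt; lia.
Qed.

(* The terms of the product of partial sums that lie outside the N x N box have
   total degree at least N, and so carry a factor rho ^+ N. *)
Lemma psum_mul a b z r A B rho : bound2 a r A -> bound2 b r B ->
  0 <= r -> 0 <= rho <= 1 -> normc z.1 <= rho * r -> normc z.2 <= rho * r ->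
  forall N, normc (psum a z N * psum b z N - psum (a * b) z N)
    <= A * B * rho ^+ N.
Proof.
move=> aA bB r0 rho01 z1 z2 N; have /andP[rho0 rho1] := rho01.
have rr : 0 <= rho * r by rewrite mulr_ge0.
pose F k m l n := a k m * b l n * z.1 ^+ (k + l) * z.2 ^+ (m + n).
have -> : psum (a * b) z N = \sum_(i < N) \sum_(j < N) \sum_(k < i.+1)
    \sum_(m < j.+1) F k m (i - k)%N (j - m)%N.
  apply: eq_bigr => i _; apply: eq_bigr => j _.
  rewrite fps2_mulE -mulrA mulr_suml; apply: eq_bigr => k _.
  rewrite mulr_suml; apply: eq_bigr => m _.
  by rewrite /F !subnKC ?mulrA // -ltnS.
rewrite conv_sum2 /psum.
rewrite (mul_box_sums (fun k m => a k m * z.1 ^+ k * z.2 ^+ m)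
  (fun l n => b l n * z.1 ^+ l * z.2 ^+ n)).
rewrite -sumrB; apply: le_trans (normc_sum _ _ _) _.
have r0' n : 0 <= r ^+ n by rewrite exprn_ge0.
have sum0 c : 0 <= \sum_(i < N) \sum_(j < N) normc (c i j) * r ^+ (i + j) :> R.
  by do 2 (apply: sumr_ge0 => ? _); rewrite mulr_ge0 ?normc_ge0.
have := ler_pM (sum0 a) (sum0 b) (aA N) (bB N); rewrite (mul_box_sums
  (fun k m => normc (a k m) * r ^+ (k + m)) (fun l n => normc (b l n) * r ^+ (l + n))).
move=> /(ler_wpM2r (exprn_ge0 N rho0)) H; apply: le_trans H.
rewrite mulr_suml; apply: ler_sum => k _; rewrite -sumrB.
rewrite mulr_suml; apply: le_trans (normc_sum _ _ _) _; apply: ler_sum => l _.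
rewrite mulr_suml -sumrB; apply: le_trans (normc_sum _ _ _) _; apply: ler_sum => m _.
rewrite mulr_suml -sumrB; apply: le_trans (normc_sum _ _ _) _; apply: ler_sum => n _.
have -> : a k m * z.1 ^+ k * z.2 ^+ m * (b l n * z.1 ^+ l * z.2 ^+ n) = F k m l n.
  by rewrite /F !exprD; ring.
case: ifP => [|/negbT ij].
  by rewrite subrr normc0 !mulr_ge0 ?normc_ge0 ?exprn_ge0.
rewrite subr0; apply: le_trans (normc_term _ _ _ rr z1 z2) _.
have -> : normc (a k m) * r ^+ (k + m) * (normc (b l n) * r ^+ (l + n)) =
  normc (a k m * b l n) * r ^+ (k + l + (m + n)).
  by rewrite normcM !exprD; ring.
rewrite ler_wpM2l ?mulr_ge0 ?normc_ge0 ?exprn_ge0 // expr_anti //.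
by move: ij; rewrite negb_and -!leqNgt; lia.
Qed.

Lemma bound2_le a r s A : bound2 a r A -> 0 <= s <= r -> bound2 a s A.
Proof.
move=> aA /andP[s0 sr] N; apply: le_trans (aA N).
apply: ler_sum => i _; apply: ler_sum => j _.
by rewrite ler_wpM2l ?normc_ge0 // lerXn2r // nnegrE // (le_trans s0).
Qed.

Lemma eval2_approx (a : R0 R) r A rho z : bound2 a r A -> 0 <= r ->
  0 <= rho <= 2^-1 -> normc z.1 <= rho * r -> normc z.2 <= rho * r ->
  forall N, normc (psum a z N - eval2 a z) <= 2 * A * rho ^+ N.
Proof.
move=> aA r0 rho02 z1 z2 N; apply: limn_geom => //.
have /andP[rho0 rho2] := rho02.
apply: psum_diff => //; rewrite rho0; lra.
Qed.

(** Bidiscs of real radius, so that R-valued estimates combine by taking minima of radii;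
    [nearO_nbhs] returns to the topology of R[i]. *)
Definition nearO (P : C * C -> Prop) : Prop :=
  exists2 d : R, 0 < d & forall z, normc z.1 < d -> normc z.2 < d -> P z.

Lemma nearO_and P Q : nearO P -> nearO Q -> nearO (fun z => P z /\ Q z).
Proof.
move=> [d d0 dP] [e e0 eQ]; exists (Num.min d e); first by rewrite lt_min d0.
by move=> z; rewrite !lt_min => /andP[? ?] /andP[? ?]; split; [apply: dP|apply: eQ].
Qed.

Lemma nearO_imp (P Q : C * C -> Prop) :
  (forall z, P z -> Q z) -> nearO P -> nearO Q.
Proof. by move=> PQ [d d0 dP]; exists d => // z z1 z2; exact/PQ/dP. Qed.

Lemma nearO_all (I : finType) (P : I -> C * C -> Prop) :
  (forall i, nearO (P i)) -> nearO (fun z => forall i, P i z).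
Proof.
move=> PI; suff [d d0 dP] : nearO (fun z => forall i, i \in enum I -> P i z).
  by exists d => // z z1 z2 i; apply: dP; rewrite // mem_enum.
elim: (enum I) => [|i s IH]; first by exists 1.
apply: nearO_imp (nearO_and (PI i) IH) => z [Pi Ps] j; rewrite in_cons.
by case/predU1P => [->|/Ps].
Qed.

Lemma nearO_nbhs P : nearO P <-> \forall z \near ((0, 0) : C * C), P z.
Proof.
split=> [[d d0 dP]|].
  apply/nbhs_ballP; exists d%:C%C => /=; first by rewrite ltcR.
  by move=> z [/= z1 z2]; apply: dP;
    [move: z1|move: z2]; rewrite -ball_normE /= sub0r normrN norm_normc ltcR.
move/nbhs_ballP => [e /= e0 eP].
have er : e = (complex.Re e)%:C%C by rewrite RRe_real // gtr0_real.
have e0' : 0 < complex.Re e by rewrite -ltcR -er.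
exists (complex.Re e) => // z z1 z2; apply: eP.
by split; rewrite -ball_normE /= sub0r normrN norm_normc er ltcR.
Qed.

Lemma convergent2_bound (a : R0 R) : exists r A : R, 0 < r /\ bound2 a r A.
Proof. by apply/convergent2P; case: a. Qed.

Lemma half_bounds : 0 <= (2^-1 : R) <= 2^-1.
Proof. by rewrite invr_ge0 ler0n lexx. Qed.

Lemma eval2_bounded (a : R0 R) :
  exists A : R, nearO (fun z => normc (eval2 a z) <= A).
Proof.
have [r [A [r0 aA]]] := convergent2_bound a; exists (2 * A).
exists (2^-1 * r); first by rewrite mulr_gt0 ?invr_gt0.
move=> z z1 z2.
(* At N = 0 the partial sum is empty, so the error bound bounds the value itself. *)
have := eval2_approx aA (ltW r0) half_bounds (ltW z1) (ltW z2) 0%N.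
by rewrite /psum big_ord0 sub0r normcN expr0 mulr1.
Qed.

Lemma eval2M (a b : R0 R) :
  nearO (fun z => eval2 (a * b) z = eval2 a z * eval2 b z).
Proof.
have [r1 [A [r10 /bound2_le aA]]] := convergent2_bound a.
have [r2 [B [r20 /bound2_le bB]]] := convergent2_bound b.
pose r := Num.min r1 r2.
have r0 : 0 < r by rewrite lt_min r10.
have {}aA : bound2 a r A by apply: aA; rewrite ltW //= ge_min lexx.
have {}bB : bound2 b r B by apply: bB; rewrite ltW //= ge_min lexx orbT.
exists (2^-1 * r); first by rewrite mulr_gt0 ?invr_gt0.
move=> z z1 z2; have h2 := half_bounds.
have h1 : 0 <= (2^-1 : R) <= 1 by lra.
have ea := eval2_approx aA (ltW r0) h2 (ltW z1) (ltW z2).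
have eb := eval2_approx bB (ltW r0) h2 (ltW z1) (ltW z2).
have eab := psum_mul aA bB (ltW r0) h1 (ltW z1) (ltW z2).
have A0 := bound2_ge0 aA; have B0 := bound2_ge0 bB.
have ebb : normc (eval2 b z) <= 2 * B.
  by have := eb 0%N; rewrite /psum big_ord0 sub0r normcN expr0 mulr1.
apply: (@limn_geomE _ _ _ (A * B + 2 * A * B + (2 * A) * (2 * B))) => N.
have paA : normc (psum a z N) <= A.
  have := psum_diff aA (ltW r0) h1 (ltW z1) (ltW z2) (leq0n N).
  by rewrite {2}/psum big_ord0 subr0 expr0 mulr1.
rewrite [X in X - _](_ : _ = psum (a * b) z N) //.
have -> : psum (a * b) z N - eval2 a z * eval2 b z =
  - (psum a z N * psum b z N - psum (a * b) z N)
  + (psum a z N * (psum b z N - eval2 b z) + (psum a z N - eval2 a z) * eval2 b z).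
  by ring.
apply: le_trans (normcD _ _) _; rewrite normcN.
apply: le_trans (lerD (eab N) (normcD _ _)) _; rewrite !normcM.
have H1 := ler_pM (normc_ge0 _) (normc_ge0 _) paA (eb N).
have H2 := ler_pM (normc_ge0 _) (normc_ge0 _) (ea N) ebb.
apply: le_trans (lerD (lexx _) (lerD H1 H2)) _.
by rewrite le_eqVlt; apply/orP; left; apply/eqP; ring.
Qed.

Lemma eval2D (a b : R0 R) :
  nearO (fun z => eval2 (a + b) z = eval2 a z + eval2 b z).
Proof.
have [r1 [A [r10 /bound2_le aA]]] := convergent2_bound a.
have [r2 [B [r20 /bound2_le bB]]] := convergent2_bound b.
pose r := Num.min r1 r2.
have r0 : 0 < r by rewrite lt_min r10.
have {}aA : bound2 a r A by apply: aA; rewrite ltW //= ge_min lexx.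
have {}bB : bound2 b r B by apply: bB; rewrite ltW //= ge_min lexx orbT.
exists (2^-1 * r); first by rewrite mulr_gt0 ?invr_gt0.
move=> z z1 z2; have h2 := half_bounds.
have ea := eval2_approx aA (ltW r0) h2 (ltW z1) (ltW z2).
have eb := eval2_approx bB (ltW r0) h2 (ltW z1) (ltW z2).
apply: (@limn_geomE _ _ _ (2 * A + 2 * B)) => N.
rewrite [X in X - _](_ : _ = psum a z N + psum b z N); last first.
  rewrite /psum -big_split; apply: eq_bigr => i _; rewrite -big_split.
  by apply: eq_bigr => j _ /=; rewrite -!mulrDl.
rewrite opprD addrACA mulrDl; apply: le_trans (normcD _ _) _.
exact: lerD.
Qed.

Lemma psum_poly (p : {poly {poly C}}) :
  exists D, forall z N, (D <= N)%N -> psum (R0_of_poly p) z N = peval p z.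
Proof.
pose D := maxn (size p) (\max_(j < size p) size (p`_j)%R).
exists D => z N DN; rewrite /peval /psum /=.
have sp : (size p <= N)%N by apply: leq_trans DN; rewrite leq_maxl.
have spj (j : 'I_N) : (size (p`_j)%R <= N)%N.
  have [jp|pj] := ltnP j (size p); last by rewrite nth_default // size_poly0.
  apply: leq_trans DN; rewrite leq_max; apply/orP; right.
  exact: (leq_bigmax (F := fun j : 'I_(size p) => size (p`_j)%R) (Ordinal jp)).
rewrite (horner_coef_wide _ sp) exchange_big /= horner_sum.
apply: eq_bigr => j _; rewrite hornerM horner_exp hornerC.
by rewrite (horner_coef_wide _ (spj j)) mulr_suml.
Qed.

Lemma eval2_poly (p : {poly {poly C}}) z : eval2 (R0_of_poly p) z = peval p z.
Proof.
have [D DP] := psum_poly p.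
apply: cvg_lim; first exact: norm_hausdorff.
apply: (@cvg_near_cst _ C).
by exists D => // N /= DN; rewrite -(DP z N DN).
Qed.

End Evaluation.

(** * Inverses of formal and of convergent power series *)

Section FpsInverse.
Variable A : comNzRingType.
Implicit Types a b : fps A.

Lemma fps1E n : (1 : fps A) n = (n == 0%N)%:R.
Proof. by []. Qed.

Lemma fps_expr_lt (a : fps A) m n : a 0%N = 0 -> (n < m)%N -> (a ^+ m) n = 0.
Proof.
move=> a0; elim: m n => // m IH n nm; rewrite exprS fps_mulE.
apply: big1 => -[[|i] /= ilt] _; first by rewrite a0 mul0r.
by rewrite IH ?mulr0 //; lia.
Qed.

(** Geometric series in u = 1 - a. As u has no constant term, u^m reaches the coefficient of index n
    only for m <= n, so each coefficient of the inverse is a finite sum. *)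
Lemma fps_inv1 a : a 0%N = 1 -> exists b, a * b = 1.
Proof.
move=> a0; pose u := 1 - a.
have u0 : u 0%N = 0 by rewrite /u -[LHS]/((1 : fps A) 0%N - a 0%N) a0 subrr.
exists (fun n => \sum_(m < n.+1) (u ^+ m) n); apply/funext => n.
have aE : a = 1 - u by rewrite /u opprB addrC subrK.
transitivity ((a * (\sum_(m < n.+1) u ^+ m)) n).
  rewrite !fps_mulE; apply: eq_bigr => i _; congr (_ * _); rewrite fps_sumE.
  rewrite (big_ord_widen n.+1 (fun m => (u ^+ m) (n - i)%N)) ?ltnS ?leq_subr //.
  rewrite big_mkcond; apply: eq_bigr => m _; case: ifP => // /negbT.
  by rewrite -leqNgt => mn; rewrite fps_expr_lt.
have -> : a * (\sum_(m < n.+1) u ^+ m) = 1 - u ^+ n.+1.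
  by rewrite aE -(opprB u 1) mulNr -subrX1 opprB.
by rewrite -[LHS]/((1 : fps A) n - (u ^+ n.+1) n) fps_expr_lt // subr0.
Qed.

Definition fps_const (y : A) : fps A := fun n => if n == 0%N then y else 0.

Lemma fps_constM y a n : (fps_const y * a) n = y * a n.
Proof.
rewrite fps_mulE big_ord_recl /= subn0 big1 ?addr0 // => i _.
by rewrite /fps_const /= mul0r.
Qed.

Lemma fps_inv a y : a 0%N * y = 1 -> exists b, a * b = 1.
Proof.
move=> ay; have [|b ab] := @fps_inv1 (fps_const y * a).
  by rewrite fps_constM mulrC.
by exists (fps_const y * b); rewrite mulrA [a * _]mulrC.
Qed.

End FpsInverse.

Section R0Units.
Variable R : realType.
Local Notation C := R[i].

(* On a bidisc where the nonconstant part of a has l^1 norm at most half of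
   c = |a 0 0|, the recursion for b bounds its partial l^1 norm S by
   c S <= 1 + c S / 2. *)
Lemma bound2_inv (a b : fps (fps C)) : a \in @convergent2 R -> a * b = 1 ->
  a 0%N 0%N != 0 -> b \in @convergent2 R.
Proof.
move=> /convergent2P[r [A [r0 aA]]] ab a00; apply/convergent2P.
pose c := normc (a 0%N 0%N); have c0 : 0 < c by rewrite normc_gt0.
have A0 := bound2_ge0 aA.
(* Shrinking the radius by s <= 1 multiplies every nonconstant term by at most s, and s A <= c /
   2. *)
pose s := Num.min 1 (c / (2 * (A + 1))).
have s0 : 0 < s.
  by rewrite lt_min ltr01 /= divr_gt0 // mulr_gt0 // ltr_wpDl.
have s1 : s <= 1 by rewrite ge_min lexx.
have sA : s * A <= c / 2.
  have : s <= c / (2 * (A + 1)) by rewrite ge_min lexx orbT.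
  rewrite ler_pdivlMr; [nra|lra].
have sr0 : 0 < s * r by rewrite mulr_gt0.
exists (s * r), (2 / c); split=> // N.
set S := \sum_(i < N) _.
pose a' i j := if (i + j == 0)%N then 0 else a i j.
pose P i j := normc (a' i j) * (s * r) ^+ (i + j).
pose Q i j := normc (b i j) * (s * r) ^+ (i + j).
have sr n : 0 <= (s * r) ^+ n by rewrite exprn_ge0 // ltW.
have P0 i j : 0 <= P i j by rewrite mulr_ge0 ?normc_ge0.
have Q0 i j : 0 <= Q i j by rewrite mulr_ge0 ?normc_ge0.
have S0 : 0 <= S by do 2 (apply: sumr_ge0 => ? _); exact: Q0.
have PA : \sum_(i < N) \sum_(j < N) P i j <= c / 2.
  apply: le_trans sA; apply: le_trans (ler_wpM2l (ltW s0) (aA N)).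
  rewrite mulr_sumr; apply: ler_sum => i _; rewrite mulr_sumr.
  apply: ler_sum => j _; rewrite /P /a'; case: ifP => [_|/negbT ij].
    by rewrite normc0 mul0r !mulr_ge0 ?normc_ge0 ?exprn_ge0 ?(ltW r0) ?(ltW s0).
  rewrite mulrCA ler_wpM2l ?normc_ge0 // exprMn ler_wpM2r ?exprn_ge0 ?(ltW r0) //.
  case: (i + j)%N ij => // n _; rewrite exprS ler_piMr ?(ltW s0) //.
  by rewrite exprn_ile1 // ltW.
have rec i j : c * Q i j <= (if (i + j == 0)%N then 1 else 0) +
   \sum_(k < i.+1) \sum_(m < j.+1) P k m * Q (i - k)%N (j - m)%N.
  have := congr1 (fun x : fps (fps C) => x i j) ab; rewrite fps2_mulE => E.
  have E2 : \sum_(k < i.+1) \sum_(m < j.+1) a k m * b (i - k)%N (j - m)%N =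
    a 0%N 0%N * b i j +
    \sum_(k < i.+1) \sum_(m < j.+1) a' k m * b (i - k)%N (j - m)%N.
    rewrite !(big_ord_recl i) !(big_ord_recl j) /= !subn0 /a' /= mul0r add0r.
    by rewrite !addrA.
  have {}E : a 0%N 0%N * b i j = (if (i + j == 0)%N then 1 else 0) -
    \sum_(k < i.+1) \sum_(m < j.+1) a' k m * b (i - k)%N (j - m)%N.
    apply/eqP; rewrite eq_sym subr_eq -E2 E; apply/eqP.
    by rewrite /GRing.one /= /fps_one; case: i {E E2} => [|i]; case: j.
  rewrite /Q mulrA -normcM E.
  apply: le_trans (ler_wpM2r (sr _) (normcD _ _)) _; rewrite mulrDl normcN.
  apply: lerD.
    case: ifP => [/eqP ->|_]; rewrite ?normc0 ?normc1 ?mul0r //.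
    by rewrite expr0 mulr1.
  apply: le_trans (ler_wpM2r (sr _) (normc_sum _ _ _)) _.
  rewrite mulr_suml; apply: ler_sum => k _.
  apply: le_trans (ler_wpM2r (sr _) (normc_sum _ _ _)) _.
  rewrite mulr_suml; apply: ler_sum => m _.
  have -> : (i + j = (k + m) + ((i - k) + (j - m)))%N.
    by rewrite addnACA !subnKC // -ltnS.
  by rewrite normcM exprD /P mulrACA.
have one_sum : \sum_(i < N) \sum_(j < N) (if (i + j == 0)%N then 1 else 0) <= 1 :> R.
  case: N {S S0 PA} => [|n]; first by rewrite big_ord0.
  rewrite big_ord_recl [X in _ + X]big1 ?addr0 => [|i _]; last by rewrite big1.
  by rewrite big_ord_recl big1 ?addr0.
have SE : \sum_(i < N) \sum_(j < N) \sum_(k < i.+1) \sum_(m < j.+1)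
   P k m * Q (i - k)%N (j - m)%N <= c / 2 * S.
  rewrite (conv_sum2 (fun k m l n => P k m * Q l n)).
  apply: le_trans (ler_wpM2r S0 PA); rewrite /S (mul_box_sums P Q).
  do 4 (apply: ler_sum => ? _); case: ifP => // _; exact: mulr_ge0.
have cS : c * S <= 1 + c / 2 * S.
  apply: le_trans (lerD one_sum SE); rewrite -big_split mulr_sumr.
  apply: ler_sum => i _; rewrite -big_split mulr_sumr.
  by apply: ler_sum => j _; exact: rec.
rewrite ler_pdivlMr //; lra.
Qed.

(** Formal inversion is used twice: first for the coefficient of z1^0, a series in z2, and then for
    the whole series in z1, whose constant term is now invertible. *)
Lemma R0_is_unit (a : R0 R) : series_of a 0%N 0%N != 0 -> is_unit a.
Proof.
move=> a00; have aC : series_of a \in @convergent2 R by case: a {a00}.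
have [y ay] : exists y, series_of a 0%N * y = 1.
  by apply: (@fps_inv _ _ (series_of a 0%N 0%N)^-1); rewrite mulfV.
have [b ab] := fps_inv ay.
exists (MkR0 (bound2_inv aC ab a00)); exact: val_inj.
Qed.

Lemma R0_of_poly1 : R0_of_poly 1 = 1 :> R0 R.
Proof.
apply: val_inj; apply/funext => i; apply/funext => j.
rewrite -[RHS]/((1 : fps (fps C)) i j) fps1E -[LHS]/((1 : {poly {poly C}})`_j`_i).
rewrite coef1; case: i => [|i].
  rewrite mulr1n fps1E; case: j => [|j]; first by rewrite !mulr1n coef1.
  by rewrite !mulr0n coef0.
rewrite mulr0n -[RHS]/(0 : C); case: j => [|j].
  by rewrite mulr1n coef1.
by rewrite mulr0n coef0.
Qed.

Lemma R0_of_polyD (f g : {poly {poly C}}) :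
  R0_of_poly (f + g) = R0_of_poly f + R0_of_poly g.
Proof.
apply: val_inj; apply/funext => i; apply/funext => j.
rewrite -[LHS]/((f + g)`_j`_i) -[RHS]/(f`_j`_i + g`_j`_i).
by rewrite !coefD.
Qed.

Lemma R0_of_polyM (f g : {poly {poly C}}) :
  R0_of_poly (f * g) = R0_of_poly f * R0_of_poly g.
Proof.
apply: val_inj; apply/funext => i; apply/funext => j.
rewrite -[LHS]/((f * g)`_j`_i).
pose sf (h : {poly {poly C}}) : fps (fps C) := fun i j => h`_j`_i.
rewrite -[RHS]/((sf f * sf g) i j).
rewrite fps2_mulE exchange_big coefM coef_sum; apply: eq_bigr => m _.
by rewrite coefM.
Qed.

Lemma eval2_unit (a : R0 R) : is_unit a ->
  exists2 B : R, 0 < B & nearO (fun z => B^-1 <= normc (eval2 a z) <= B).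
Proof.
move=> [b ab]; have [A Anear] := eval2_bounded a; have [B Bnear] := eval2_bounded b.
exists (Num.max 1 (Num.max A B)); first by rewrite lt_max ltr01.
apply: nearO_imp (nearO_and (eval2M a b) (nearO_and Anear Bnear)) => z.
rewrite ab -R0_of_poly1 eval2_poly /peval hornerC hornerC => -[E [zA zB]].
set K := Num.max _ _.
have [AK BK K1] : [/\ A <= K, B <= K & 1 <= K] by rewrite !le_max !lexx !orbT.
have := congr1 (@normc R) E; rewrite normc1 normcM => E1.
apply/andP; split; last exact: le_trans zA _.
have K0 : 0 < K by lra.
rewrite -[leLHS]mul1r ler_pdivrMr // E1 ler_wpM2l ?normc_ge0 //.
exact: le_trans zB _.
Qed.

(** The series is regarded as one in two variables that is constant in z2. The two-variable estimate
    then applies with ratio |t| / r, and its case N = 1 is linear in |t|. *)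
Lemma eval1_near (psi : fps C) : convergent1 psi ->
  exists d K : R, 0 < d /\
    forall t, normc t < d -> normc (eval1 psi t - psi 0%N) <= K * normc t.
Proof.
move=> [rc [Bc [horner_rc0 cB]]].
pose a : fps (fps C) := fun i j => if j == 0%N then psi i else 0.
have sE (F : nat -> nat -> C) N : \sum_(i < N) \sum_(j < N)
    (if j == 0%N :> nat then F i j else 0) = \sum_(i < N) F i 0%N.
  case: N => [|N]; first by rewrite !big_ord0.
  apply: eq_bigr => i _; rewrite big_ord_recl /= big1 ?addr0 // => j _.
have : a \in @convergent2 R.
  apply/asboolP; exists rc, Bc; split=> // N; apply: le_trans (cB N).
  pose F i j := `|psi i| * rc ^+ (i + j).
  have -> : \sum_(i < N) `|psi i| * rc ^+ i = \sum_(i < N) F i 0%N.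
    by apply: eq_bigr => i _; rewrite /F addn0.
  rewrite -(sE F).
  rewrite le_eqVlt; apply/orP; left; apply/eqP; apply: eq_bigr => i _.
  by apply: eq_bigr => j _; rewrite /a; case: ifP; rewrite ?normr0 ?mul0r.
move=> /convergent2P[r [A [r0 aA]]].
exists (2^-1 * r), (2 * A / r); split; first by rewrite mulr_gt0 // invr_gt0.
move=> t tr; pose rho := normc t / r.
have rr : rho * r = normc t by rewrite /rho mulfVK // gt_eqF.
have rho0 : 0 <= rho by rewrite divr_ge0 ?normc_ge0 // ltW.
have rho2 : rho <= 2^-1 by rewrite /rho ler_pdivrMr // ltW.
have pE N : psum a (t, 0) N = \sum_(i < N) psi i * t ^+ i.
  rewrite /psum; transitivity (\sum_(i < N) psi i * t ^+ i * 0 ^+ 0); last first.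
    by apply: eq_bigr => i _; rewrite expr0 mulr1.
  rewrite -(sE (fun i j => psi i * t ^+ i * 0 ^+ j)).
  apply: eq_bigr => i _; apply: eq_bigr => j _; rewrite /a; case: ifP => //.
  by rewrite !mul0r.
have rho01 : 0 <= rho <= 1 by lra.
have rho02 : 0 <= rho <= 2^-1 by lra.
have H : forall N M, (N <= M)%N -> normc (\sum_(i < M) psi i * t ^+ i -
    \sum_(i < N) psi i * t ^+ i) <= A * rho ^+ N.
  move=> N M NM; rewrite -!pE; apply: (psum_diff aA (ltW r0)) => //.
    by rewrite -[normc _]/(normc t) rr.
  by rewrite -[leLHS]/(normc (0 : C)) normc0 rr normc_ge0.
have := limn_geom rho02 H 1%N.
rewrite big_ord_recl big_ord0 addr0 expr0 mulr1 normcB expr1.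
suff -> : 2 * A * rho = 2 * A / r * normc t by [].
by rewrite /rho mulrA mulrAC.
Qed.

End R0Units.

(** * Domination on H^2 near the origin *)

Section PolynomialEvaluation.
Variable R : realType.
Local Notation C := R[i].
Implicit Types (p f g : {poly {poly C}}) (z : C * C).

Lemma pevalD f g z : peval (f + g) z = peval f z + peval g z.
Proof. by rewrite /peval !hornerD. Qed.
Lemma pevalN f z : peval (- f) z = - peval f z.
Proof. by rewrite /peval !hornerN. Qed.
Lemma pevalXn f n z : peval (f ^+ n) z = peval f z ^+ n.
Proof. by rewrite /peval !horner_exp. Qed.
Lemma peval_prod (I : Type) (r : seq I) (P : pred I) F z :
  peval (\prod_(i <- r | P i) F i) z = \prod_(i <- r | P i) peval (F i) z.
Proof. by rewrite /peval !horner_prod. Qed.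
Lemma pevalC (g : {poly C}) z : peval g%:P z = g.[z.1].
Proof. by rewrite /peval hornerC. Qed.
Lemma pevalX z : peval 'X z = z.2.
Proof. by rewrite /peval hornerX hornerC. Qed.
Lemma peval_segment (q : {poly R}) z :
  peval (segment q) z = z.2 + (real_to_complex_poly q).[z.1].
Proof. by rewrite pevalD pevalX pevalC. Qed.

(** The expansion of f around z, since [analytic_at] asks for a power series in the displacement
    h. *)
Definition shift_poly f z : {poly {poly C}} :=
  map_poly (comp_poly ('X + z.1%:P)) f \Po ('X + z.2%:P%:P).

Lemma peval_shift f z h : peval (shift_poly f z) h = peval f (z.1 + h.1, z.2 + h.2).
Proof.
rewrite /peval horner_comp hornerD hornerX hornerC.
have -> : h.2%:P + z.2%:P = comp_poly ('X + z.1%:P) (z.2 + h.2)%:P.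
  by rewrite comp_polyC rmorphD addrC.
by rewrite horner_map horner_comp hornerD hornerX hornerC [h.1 + _]addrC.
Qed.

(** Recentred at z, the denominator has a nonzero constant coefficient and is a unit of R0. *)
Lemma analytic_div f g z : peval g z != 0 ->
  analytic_at (fun z => peval f z / peval g z) z.
Proof.
move=> gz.
have [b gb] : is_unit (R0_of_poly (shift_poly g z)).
  apply: R0_is_unit; rewrite /= -!horner_coef0; move: gz; congr (_ != 0).
  by have := peval_shift g z (0, 0); rewrite /peval /= !addr0 => <-.
exists (R0_of_poly (shift_poly f z) * b).
apply/nearO_nbhs; apply: nearO_imp (nearO_and (eval2M (R0_of_poly (shift_poly f z)) b)
  (eval2M (R0_of_poly (shift_poly g z)) b)) => h [-> ].
rewrite gb -R0_of_poly1 !eval2_poly !peval_shift.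
rewrite -[X in peval X h]/(1%:P) pevalC hornerC => E.
have gh : peval g (z.1 + h.1, z.2 + h.2) != 0.
  by apply: contra_eq_neq E => ->; rewrite mul0r oner_neq0.
by congr (_ * _); apply: (mulfI gh); rewrite -E mulfV.
Qed.

End PolynomialEvaluation.

Section Domination.
Variable R : realType.
Local Notation C := R[i].
Implicit Types (F G : C * C -> C) (z : C * C).

Definition dom F G := exists2 K : R, 0 < K &
  nearO (fun z => H2 z -> normc (F z) <= K * normc (G z)).

Lemma dom_refl F : dom F F.
Proof. by exists 1 => //; exists 1 => // z _ _ _; rewrite mul1r. Qed.

Lemma dom_trans F G H : dom F G -> dom G H -> dom F H.
Proof.
move=> [K K0 FG] [L L0 GH]; exists (K * L); first exact: mulr_gt0.
apply: nearO_imp (nearO_and FG GH) => z [fg gh] hz.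
apply: le_trans (fg hz) _; rewrite -mulrA ler_wpM2l ?gh //; exact: ltW.
Qed.

Lemma dom_eq F G : nearO (fun z => F z = G z) -> dom F G.
Proof. by move=> FG; exists 1 => //; apply: nearO_imp FG => z ->; rewrite mul1r. Qed.

Lemma domM F G F' G' : dom F F' -> dom G G' ->
  dom (fun z => F z * G z) (fun z => F' z * G' z).
Proof.
move=> [K K0 FG] [L L0 GH]; exists (K * L); first exact: mulr_gt0.
apply: nearO_imp (nearO_and FG GH) => z [fg gh] hz; rewrite !normcM.
apply: le_trans (ler_pM (normc_ge0 _) (normc_ge0 _) (fg hz) (gh hz)) _.
by rewrite mulrACA.
Qed.

Lemma domD F G H : dom F H -> dom G H -> dom (fun z => F z + G z) H.
Proof.
move=> [K K0 FG] [L L0 GH]; exists (K + L); first exact: addr_gt0.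
apply: nearO_imp (nearO_and FG GH) => z [fg gh] hz.
apply: le_trans (normcD _ _) _; rewrite mulrDl.
by apply: lerD; [exact: fg|exact: gh].
Qed.

Lemma dom_prod (I : Type) (r : seq I) (F G : I -> C * C -> C) :
  (forall i, dom (F i) (G i)) ->
  dom (fun z => \prod_(i <- r) F i z) (fun z => \prod_(i <- r) G i z).
Proof.
move=> FG; elim: r => [|i r IH].
  by apply: dom_eq; exists 1 => // z _ _; rewrite !big_nil.
apply: dom_trans (dom_trans (domM (FG i) IH) _);
  by apply: dom_eq; exists 1 => // z _ _; rewrite !big_cons.
Qed.

Lemma dom_bounded F (A : R) : nearO (fun z => normc (F z) <= A) -> dom F (fun=> 1).
Proof.
move=> FA; exists (Num.max 1 A); first by rewrite lt_max ltr01.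
by apply: nearO_imp FA => z FA _; rewrite normc1 mulr1 le_max FA orbT.
Qed.

Lemma Hinf_of_dom (f g : {poly {poly C}}) : dom (peval f) (peval g) ->
  nearO (fun z => H2 z -> peval g z != 0) ->
  locally_Hinf (fun z => peval f z / peval g z).
Proof.
move=> [K K0 fK] g0; have [d d0 dP] := nearO_and fK g0.
pose U : set (C * C) := ball ((0, 0) : C * C) d%:C%C.
have UP z : U z -> normc z.1 < d /\ normc z.2 < d.
  move=> [/= z1 z2]; split; [move: z1|move: z2];
  by rewrite -ball_normE /= sub0r normrN norm_normc ltcR.
have d0' : 0 < d%:C%C by rewrite ltcR.
exists (interior U); split.
- split; first exact: open_interior.
  by apply: nbhsx_ballx.
- move=> z [/interior_subset /UP [z1 z2] hz]; apply: analytic_div.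
  by have [_ /(_ hz)] := dP z z1 z2.
- exists K%:C%C => z [/interior_subset /UP [z1 z2] hz].
  have [/(_ hz) fg /(_ hz) gz] := dP z z1 z2.
  by rewrite norm_normc lecR normcM normcV ler_pdivrMr // normc_gt0.
Qed.

Lemma dom_of_Hinf (f g : {poly {poly C}}) :
  locally_Hinf (fun z => peval f z / peval g z) ->
  nearO (fun z => H2 z -> peval g z != 0) -> dom (peval f) (peval g).
Proof.
move=> [U [[Uo U0] _ [B UB]]] g0.
have UN : nearO U by apply/nearO_nbhs; exact: open_nbhs_nbhs.
exists (Num.max 1 (complex.Re B)); first by rewrite lt_max ltr01.
apply: nearO_imp (nearO_and UN g0) => z [Uz gz] hz.
have {}gz := gz hz; have := UB z (conj Uz hz).
rewrite norm_normc lecE => /andP[_ /=]; rewrite normcM normcV => fB.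
rewrite -ler_pdivrMr ?normc_gt0 //; apply: le_trans fB _.
by rewrite le_max lexx orbT.
Qed.

End Domination.

(** * Imaginary parts of real polynomials and of even powers *)

Section PolynomialBounds.
Variable R : realType.
Local Notation C := R[i].
Implicit Types (g : {poly C}) (q s : {poly R}).
Local Notation rc := (@real_to_complex_poly R).

Lemma poly_split (A : comNzRingType) (g : {poly A}) :
  exists h, g = h * 'X + (g`_0)%:P.
Proof.
elim/poly_ind: g => [|g c _]; first by exists 0; rewrite coef0 mul0r addr0.
by exists g; rewrite coefD coefMX coefC eqxx add0r.
Qed.

Lemma poly_bounded g :
  exists2 B : R, 0 <= B & forall z, normc z <= 1 -> normc g.[z] <= B.
Proof.
elim/poly_ind: g => [|g c [B B0 gB]].
  by exists 0 => // z _; rewrite horner0 normc0.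
exists (B + normc c) => [|z z1]; first by rewrite addr_ge0 ?normc_ge0.
rewrite !hornerE; apply: le_trans (normcD _ _) _; rewrite lerD2r normcM.
by have := normc_ge0 z; have := gB z z1; have := normc_ge0 g.[z]; nra.
Qed.

Lemma Im_mul (z w : C) : complex.Im (z * w) =
  complex.Re z * complex.Im w + complex.Im z * complex.Re w.
Proof. by case: z w => a b [c d]. Qed.
Lemma ImD (z w : C) : complex.Im (z + w) = complex.Im z + complex.Im w.
Proof. by case: z w => a b [c d]. Qed.
Lemma ImB (z w : C) : complex.Im (z - w) = complex.Im z - complex.Im w.
Proof. by case: z w => a b [c d]. Qed.

(** A polynomial with real coefficients is real on the real axis, so its imaginary part is
    controlled by the distance to that axis. In the induction the constant c adds nothing to the
    imaginary part. *)
Lemma real_poly_Im s : exists2 K : R, 0 <= K & forall z : C, normc z <= 1 ->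
  0 <= complex.Im z -> `|complex.Im (rc s).[z]| <= K * complex.Im z.
Proof.
elim/poly_ind: s => [|s c [K K0 sK]].
  by exists 0 => // z _ _; rewrite /real_to_complex_poly rmorph0 horner0 normr0 mul0r.
have [B B0 sB] := poly_bounded (rc s).
exists (K + B) => [|z z1 y0]; first exact: addr_ge0.
rewrite /real_to_complex_poly rmorphD rmorphM /= map_polyX map_polyC !hornerE.
rewrite ImD addr0 Im_mul; apply: le_trans (ler_normD _ _) _; rewrite !normrM.
have := sB z z1; have := sK z z1 y0; have := Re_le_normc (rc s).[z].
have := Re_le_normc z; rewrite [`|complex.Im z|]ger0_norm // /real_to_complex_poly.
move: (normr_ge0 (complex.Re z)) (normr_ge0 (complex.Im (map_poly (real_complex R) s).[z])).
move: (complex.Im z) (complex.Re z) y0 z1 => y x y0 z1 ? ? ? ? ? ?.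
have : `|complex.Re (map_poly (real_complex R) s).[z]| * y <= B * y by apply: ler_wpM2r; lra.
have : `|complex.Im (map_poly (real_complex R) s).[z]| * `|x| <= K * y * 1.
  by apply: ler_pM => //; lra.
lra.
Qed.

(** Write q = c z + z^2 q2 with c = q'(0). The linear part contributes c Im z, and the imaginary
    part of the rest is at most (2 B + 2 K) |z| Im z, where B bounds q2 and K comes from
    [real_poly_Im]; near 0 this costs at most half of c Im z. *)
Lemma Im_segment_ge q : q.[0] = 0 -> 0 < q^`().[0] -> exists2 d : R, 0 < d &
  forall z : C, normc z < d -> 0 <= complex.Im z ->
    q^`().[0] / 2 * complex.Im z <= complex.Im (rc q).[z].
Proof.
have [q1 q1E] := poly_split q; have [q2 q2E] := poly_split q1.
rewrite -!horner_coef0 in q1E q2E.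
move=> q0; rewrite q0 polyC0 addr0 in q1E.
have -> : q^`().[0] = q1.[0].
  by rewrite q1E derivM derivX mulr1 hornerD hornerM hornerX mulr0 add0r.
move=> c0; rewrite q1E.
set c := q1.[0] in c0 q2E *.
have [B B0 sB] := poly_bounded (rc q2); have [K K0 sK] := real_poly_Im q2.
exists (Num.min 1 (c / (2 * (2 * B + 2 * K + 1)))).
  by rewrite lt_min ltr01 divr_gt0 //; lra.
move=> z; rewrite lt_min => /andP[z1]; rewrite ltr_pdivlMr; last lra.
move=> zc y0; have {}sB := sB z (ltW z1); have {}sK := sK z (ltW z1) y0.
rewrite q2E /real_to_complex_poly !(rmorphD, rmorphM) /= map_polyX map_polyC !hornerE.
rewrite -[map_poly _ q2]/(rc q2) in sB sK *.
set w := (rc q2).[z] in sB sK *.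
have -> : (w * z + c%:C%C) * z = c%:C%C * z + z * (w * z) by ring.
rewrite ImD (Im_mul _ (w * z)) !Im_mul /= mul0r addr0.
have hw : complex.Re (w * z) = complex.Re w * complex.Re z - complex.Im w * complex.Im z.
  by case: (w) (z) => a b [? ?].
rewrite hw; have := Re_le_normc z; have := Re_le_normc w; have := Im_le_normc z.
have nz := normc_ge0 z; move: z1 zc y0 sB sK nz {hw}.
move: (normc z) (normc w) (complex.Re z) (complex.Im z) (complex.Re w) (complex.Im w).
move=> r v x y a b r1 rc y0 vB bK r0 yr av xr.
have Ka : `|a| <= B by lra.
have y1 : y <= r by have := ler_norm y; lra.
have h1 : `|x * (a * y)| <= r * (B * y).
  rewrite !normrM (ger0_norm y0); apply: ler_pM => //; first by rewrite mulr_ge0.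
  by apply: ler_wpM2r.
have h2 : `|x * (b * x)| <= r * (K * y).
  rewrite !normrM; apply: ler_pM => //.
  rewrite -[leRHS]mulr1; apply: ler_pM => //; lra.
have h4 : `|y * (b * y)| <= r * (K * y).
  rewrite !normrM (ger0_norm y0); apply: ler_pM; rewrite ?mulr_ge0 //.
  rewrite -[leRHS]mulr1; apply: ler_pM => //; lra.
move: h1 h2 h4; rewrite !ler_norml => /andP[h1 _] /andP[h2 _] /andP[_ h4].
have ry : 0 <= r * y by rewrite mulr_ge0.
have := ler_wpM2r y0 (ltW rc); lra.
Qed.

(* Induction from z^2 - |z|^2 = 2 i (Im z) z. *)
Lemma even_power_Im (L : nat) (z : C) : normc z <= 1 -> 0 <= complex.Im z ->
  normc (z ^+ (2 * L) - (normc z)%:C%C ^+ (2 * L))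
    <= 2 * L%:R * complex.Im z * normc z.
Proof.
move=> z1 y0; elim: L => [|L IH].
  by rewrite muln0 !expr0 subrr normc0 !mulr_ge0 ?normc_ge0.
set r := (normc z)%:C%C.
have sq : z ^+ 2 - r ^+ 2 = (2 * complex.Im z)%:C%C * 'i%C * z.
  rewrite /r -rmorphXn /normc; case: (z) => x y /=; rewrite sqr_sqrtr ?addr_ge0 ?sqr_ge0 //.
  by apply/eqP; rewrite eq_complex /=; apply/andP; split; apply/eqP => /=; ring.
have -> : z ^+ (2 * L.+1) - r ^+ (2 * L.+1) =
  z ^+ 2 * (z ^+ (2 * L) - r ^+ (2 * L)) + r ^+ (2 * L) * (z ^+ 2 - r ^+ 2).
  by rewrite mulnS !exprD; ring.
rewrite sq; apply: le_trans (normcD _ _) _; rewrite !normcM !normcX /r !normc_real.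
have -> : normc ('i%C : C) = 1 by rewrite /normc /= expr0n expr1n /= add0r sqrtr1.
rewrite mulr1 !ger0_norm ?normc_ge0 ?mulr_ge0 //.
have e1 : normc z ^+ 2 <= 1 by rewrite exprn_ile1 // normc_ge0.
have e2 : normc z ^+ (2 * L) <= 1 by rewrite exprn_ile1 // normc_ge0.
rewrite -natr1; set y := complex.Im z in y0 IH *.
have a0 : 0 <= 2 * y * normc z by rewrite !mulr_ge0 ?normc_ge0.
have h1 := ler_wpM2r a0 e2.
have h2 := ler_wpM2r (normc_ge0 (z ^+ (2 * L) - r ^+ (2 * L))) e1.
rewrite -/r in IH h2 *; lra.
Qed.

End PolynomialBounds.

Section Factors.
Variable R : realType.
Local Notation C := R[i].
Local Notation rc := (@real_to_complex_poly R).

Lemma factor_lower (q : {poly R}) (L : nat) (B eta : R) :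
  q.[0] = 0 -> 0 < q^`().[0] -> exists2 d : R, 0 < d &
  forall (z : C * C) w, H2 z -> normc z.1 < d -> normc w <= B ->
    eta <= complex.Im w ->
    eta * normc z.1 ^+ (2 * L) <= normc (z.2 + (rc q).[z.1] + z.1 ^+ (2 * L) * w).
Proof.
move=> q0 dq0; have [d d0 dP] := Im_segment_ge q0 dq0.
set c := q^`().[0] in dq0 dP.
(* This radius makes 2 L |z1| |B| Im z1, the cost of replacing z1^(2L) by its modulus, at most half
   of q'(0) Im z1, which [Im_segment_ge] supplies. The term Im z2 is positive. *)
exists (Num.min d (Num.min 1 (c / (2 * (2 * L%:R * `|B| + 1))))).
  by rewrite !lt_min d0 ltr01 divr_gt0 // mulr_gt0 // ltr_wpDl // !mulr_ge0.
move=> [z1 z2] w [/= y1 y2]; rewrite !lt_min => /and3P[zd z11 zc] wB we.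
move: zc; rewrite ltr_pdivlMr; last by rewrite mulr_gt0 // ltr_wpDl // !mulr_ge0.
move=> zc; apply: le_trans (le_trans (ler_norm _) (Im_le_normc _)).
rewrite !ImD; have := dP z1 zd (ltW y1) => hq.
have he := even_power_Im L (ltW z11) (ltW y1).
set E := z1 ^+ (2 * L) - _ in he.
have -> : z1 ^+ (2 * L) * w = (normc z1 ^+ (2 * L))%:C%C * w + E * w.
  by rewrite /E rmorphXn; ring.
rewrite ImD Im_mul /= mul0r addr0.
have : `|complex.Im (E * w)| <= 2 * L%:R * complex.Im z1 * normc z1 * `|B|.
  apply: le_trans (Im_le_normc _) _; rewrite normcM; apply: ler_pM; rewrite ?normc_ge0 //.
  exact: le_trans wB (ler_norm _).
rewrite ler_norml => /andP[hE _].
have hp : 0 <= normc z1 ^+ (2 * L) by rewrite exprn_ge0 ?normc_ge0.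
have := ler_wpM2l hp we.
have : complex.Im z1 * (normc z1 * (2 * (2 * L%:R * `|B| + 1))) <= complex.Im z1 * c.
  by rewrite ler_wpM2l // ltW.
have := normc_ge0 z1; nra.
Qed.

Lemma H2_neq0 (z : C * C) : H2 z -> 0 < normc z.1.
Proof. by move=> [y1 _]; apply: lt_le_trans (le_trans (ler_norm _) (Im_le_normc _)). Qed.

(* The branches of p are the case w = psi, the factors of [p] the case w = i. *)
Definition factor (q : {poly R}) (L : nat) (w : C * C -> C) (z : C * C) : C :=
  z.2 + (rc q).[z.1] + z.1 ^+ (2 * L) * w z.

(** Stated by bounds alone, so that it covers the constant i as well as psi evaluated at a
    discontinuous choice of root of z1. *)
Definition upper (w : C * C -> C) := exists B eta : R, 0 < eta /\
  nearO (fun z => normc (w z) <= B /\ eta <= complex.Im (w z)).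

Lemma upper_const (w : C) : 0 < complex.Im w -> upper (fun=> w).
Proof.
by move=> w0; exists (normc w), (complex.Im w); split=> //; exists 1.
Qed.

Lemma factor_lower_near q L w : q.[0] = 0 -> 0 < q^`().[0] -> upper w ->
  exists2 eta : R, 0 < eta &
  nearO (fun z => H2 z -> eta * normc z.1 ^+ (2 * L) <= normc (factor q L w z)).
Proof.
move=> q0 dq0 [B [eta [eta0 wB]]]; exists eta => //.
have [d d0 dP] := factor_lower L B eta q0 dq0.
have dn : nearO (fun z : C * C => normc z.1 < d) by exists d.
by apply: nearO_imp (nearO_and dn wB) => z [zd [zB ze]] hz; apply: dP.
Qed.

Lemma factor_neq0 q L w : q.[0] = 0 -> 0 < q^`().[0] -> upper w ->
  nearO (fun z => H2 z -> factor q L w z != 0).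
Proof.
move=> q0 dq0 wu; have [eta eta0] := factor_lower_near L q0 dq0 wu.
apply: nearO_imp => z zP hz; rewrite -normc_gt0; apply: lt_le_trans (zP hz).
by rewrite mulr_gt0 ?exprn_gt0 ?H2_neq0.
Qed.

Lemma dom_power_factor q L w : q.[0] = 0 -> 0 < q^`().[0] -> upper w ->
  dom (fun z => z.1 ^+ (2 * L)) (factor q L w).
Proof.
move=> q0 dq0 wu; have [eta eta0 zP] := factor_lower_near L q0 dq0 wu.
exists eta^-1; first by rewrite invr_gt0.
apply: nearO_imp zP => z zP hz.
by rewrite normcX mulrC ler_pdivlMr // mulrC zP.
Qed.

Lemma upper_dom (w : C * C -> C) : upper w -> dom w (fun=> 1).
Proof.
move=> [B [eta [_ wB]]]; apply: (@dom_bounded _ _ B).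
by apply: nearO_imp wB => z [].
Qed.

(** The two factors differ by z1^(2L) (w - w'), where w - w' is bounded and z1^(2L) is dominated by
    the factor of w'. *)
Lemma dom_factor q L w w' : q.[0] = 0 -> 0 < q^`().[0] -> upper w -> upper w' ->
  dom (factor q L w) (factor q L w').
Proof.
move=> q0 dq0 wu wu'; have zz := dom_power_factor L q0 dq0 wu'.
have mul1 (v : C * C -> C) : dom v (fun=> 1) ->
    dom (fun z => z.1 ^+ (2 * L) * v z) (factor q L w').
  move=> v1; apply: dom_trans (domM zz v1) _.
  by apply: dom_eq; exists 1 => // z _ _; rewrite mulr1.
have h1 : dom (fun z => z.1 ^+ (2 * L) * w z) (factor q L w').
  exact/mul1/upper_dom.
have h2 : dom (fun z => z.1 ^+ (2 * L) * (-1 * w' z)) (factor q L w').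
  apply: mul1; apply: dom_trans (domM (dom_refl (fun=> -1)) (upper_dom wu')) _.
  by apply: (@dom_bounded _ _ 1); exists 1 => // z _ _; rewrite mulr1 normcN normc1.
apply: dom_trans (domD (domD (dom_refl (factor q L w')) h1) h2).
by apply: dom_eq; exists 1 => // z _ _; rewrite /factor; ring.
Qed.

Lemma dom_segment q L w : q.[0] = 0 -> 0 < q^`().[0] -> upper w ->
  dom (fun z => z.2 + (rc q).[z.1]) (factor q L w).
Proof.
move=> q0 dq0 wu; have zz := dom_power_factor L q0 dq0 wu.
have h1 : dom (fun z => z.1 ^+ (2 * L) * (-1 * w z)) (factor q L w).
  apply: dom_trans (domM zz (domM (dom_refl (fun=> -1)) (upper_dom wu))) _.
  apply: dom_trans (domM (dom_refl _) (_ : dom _ (fun=> 1))) _.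
  - by apply: (@dom_bounded _ _ 1); exists 1 => // z _ _; rewrite mulr1 normcN normc1.
  - by apply: dom_eq; exists 1 => // z _ _; rewrite mulr1.
apply: dom_trans (domD (dom_refl (factor q L w)) h1).
by apply: dom_eq; exists 1 => // z _ _; rewrite /factor; ring.
Qed.

End Factors.

(** * Comparison of p, [p] and the product ideal *)

Section Comparison.
Variable R : realType.
Local Notation C := R[i].
Local Notation rc := (@real_to_complex_poly R).

Lemma normc_root_mu (M m : nat) : normc (root_mu R M ^+ m) = 1.
Proof.
rewrite normcX /normc /root_mu cos2Dsin2 sqrtr1 expr1n //.
Qed.

(** Only the modulus of the chosen root matters: it is small with |z1|, and then psi stays within Im
    psi(0) / 2 of psi(0). *)
Lemma upper_branch (psi : fps C) (M m : nat) : convergent1 psi ->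
  0 < complex.Im (psi 0%N) -> (0 < M)%N ->
  upper (fun z : C * C => eval1 psi (root_mu R M ^+ m * M.-root z.1)).
Proof.
move=> psiC psi0 M0; have [d [K [d0 dK]]] := eval1_near psiC.
set b := complex.Im (psi 0%N) in psi0.
pose e := Num.min d (b / (2 * (`|K| + 1))).
have e0 : 0 < e by rewrite lt_min d0 divr_gt0 // mulr_gt0 // ltr_wpDl.
exists (normc (psi 0%N) + b), (b / 2); split; first by rewrite divr_gt0.
(* For |z1| < e^M every M-th root of z1 has modulus below e. *)
exists (e ^+ M) => [|z z1 _]; first by rewrite exprn_gt0.
set t := _ * _.
have te : normc t < e.
  rewrite /t normcM normc_root_mu mul1r ltNge; apply/negP => et.
  have := lerXn2r M (ltW e0 : _ \in Num.nneg) (normc_ge0 _ : _ \in Num.nneg) et.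
  by rewrite -normcX rootCK // leNgt z1.
move: te; rewrite lt_min => /andP[td tb].
have h : normc (eval1 psi t - psi 0%N) <= b / 2.
  apply: le_trans (dK t td) _; move: tb; rewrite ltr_pdivlMr; last first.
    by rewrite mulr_gt0 // ltr_wpDl.
  have := normc_ge0 t; have := ler_norm K; nra.
split.
  have -> : eval1 psi t = psi 0%N + (eval1 psi t - psi 0%N) by rewrite addrC subrK.
  apply: le_trans (normcD _ _) _; lra.
have := le_trans (Im_le_normc _) h; rewrite ImB ler_norml -/b; lra.
Qed.

Variables (p : {poly {poly C}}) (k : nat) (M L : 'I_k -> nat).
Variables (q : 'I_k -> {poly R}) (psi : 'I_k -> fps C).
Hypothesis hdata : puiseux_data p M L q psi.

Let ifac j : C * C -> C := factor (q j) (L j) (fun=> 'i%C).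

Let upper_i : upper (fun=> ('i%C : C)). Proof. by apply: upper_const; rewrite /= ltr01. Qed.

Lemma peval_bracket z : peval (bracket M L q) z = \prod_j ifac j z ^+ M j.
Proof.
rewrite /bracket peval_prod; apply: eq_bigr => j _.
by rewrite pevalXn pevalD peval_segment pevalC !hornerE mulrC.
Qed.

Lemma bracket_neq0 : nearO (fun z => H2 z -> peval (bracket M L q) z != 0).
Proof.
have := nearO_all (fun j => factor_neq0 (L j) (puiseux_q0 hdata j)
  (puiseux_dq0 hdata j) upper_i).
apply: nearO_imp => z zP hz; rewrite peval_bracket.
by apply/prodf_neq0 => j _; rewrite expf_neq0 // zP.
Qed.

Let bfac j m : C * C -> C := factor (q j) (L j)
  (fun z => eval1 (psi j) (root_mu R (M j) ^+ m * (M j).-root z.1)).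

Let upper_psi j m : upper (fun z : C * C => eval1 (psi j) (root_mu R (M j) ^+ m * (M j).-root z.1)).
Proof.
by apply: upper_branch; [exact: puiseux_psi hdata j|exact: puiseux_psi0 hdata j|
  exact: puiseux_M_gt0 hdata j].
Qed.

Let ifacE j z : ifac j z ^+ M j = \prod_(1 <= m < (M j).+1) ifac j z.
Proof. by rewrite prodr_const_nat subSS subn0. Qed.

Lemma dom_p_bracket : dom (peval p) (peval (bracket M L q)) /\
  dom (peval (bracket M L q)) (peval p).
Proof.
have [u uu /nearO_nbhs up] := puiseux_factorization hdata.
have [B B0 uB] := eval2_unit uu.
have u1 : dom (eval2 u) (fun=> 1).
  by apply: (@dom_bounded _ _ B); apply: nearO_imp uB => z /andP[].
have u2 : dom (fun=> 1) (eval2 u).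
  exists B => //; apply: nearO_imp uB => z /andP[uz _] _.
  by rewrite normc1 -ler_pdivrMl // mulr1.
have pE : nearO (fun z => peval p z = eval2 u z *
    \prod_j \prod_(1 <= m < (M j).+1) bfac j m z).
  (* The factorization holds for every choice of roots, hence for the one made by [M.-root]. *)
  apply: nearO_imp up => z /(_ (fun j => (M j).-root z.1)) -> // j.
  by rewrite rootCK ?(puiseux_M_gt0 hdata j).
have bE : nearO (fun z => peval (bracket M L q) z = 1 *
    \prod_j \prod_(1 <= m < (M j).+1) ifac j z).
  exists 1 => // z _ _; rewrite mul1r peval_bracket.
  by apply: eq_bigr => j _; rewrite ifacE.
pose pF (z : C * C) := eval2 u z * \prod_j \prod_(1 <= m < (M j).+1) bfac j m z.
pose bF (z : C * C) := 1 * \prod_j \prod_(1 <= m < (M j).+1) ifac j z.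
have pE' : dom pF (peval p) by apply: dom_eq; apply: nearO_imp pE => z ->.
have bE' : dom bF (peval (bracket M L q)).
  by apply: dom_eq; apply: nearO_imp bE => z ->.
have q0 := puiseux_q0 hdata; have dq0 := puiseux_dq0 hdata.
split.
  apply: (dom_trans (G := pF)); [exact: dom_eq|apply: dom_trans bE'].
  apply: domM => //; apply: dom_prod => j; apply: dom_prod => m.
  exact: dom_factor.
apply: (dom_trans (G := bF)); [exact: dom_eq|apply: dom_trans pE'].
apply: domM => //; apply: dom_prod => j; apply: dom_prod => m.
exact: dom_factor.
Qed.

(** Constant and radius may depend on the element. This suffices for products of ideals, whose
    elements are finite sums of products. *)
Let dom_ideal (I : set (R0 R)) (G : C * C -> C) := forall a, I a -> dom (eval2 a) G.

Let dom_ideal_mul I J F G : dom_ideal I F -> dom_ideal J G ->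
  dom_ideal (ideal_mul I J) (fun z => F z * G z).
Proof.
move=> IF JG x [n [a [b [ab ->]]]].
elim: n a b ab => [|n IH] a b ab.
  rewrite big_ord0; apply: (@dom_trans _ _ (fun=> 0)).
    (* The value e of the zero series satisfies e = e + e near the origin. *)
    have := eval2D (0 : R0 R) 0; rewrite addr0 => e0; apply: dom_eq.
    by apply: nearO_imp e0 => z /eqP; rewrite -subr_eq subrr eq_sym => /eqP.
  exists 1 => //; exists 1 => // z _ _ _.
  by rewrite normc0 mul1r normc_ge0.
rewrite big_ord_recl; apply: dom_trans (dom_eq (eval2D _ _)) _.
apply: domD; last by apply: IH => i; exact: ab.
apply: dom_trans (dom_eq (eval2M _ _)) _.
have [Ia Jb] := ab ord0; apply: domM; [exact: IF|exact: JG].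
Qed.

Let dom_idealT : dom_ideal setT (fun=> 1).
Proof. by move=> a _; have [A] := eval2_bounded a; exact: dom_bounded. Qed.

Let dom_ideal_le I F G : dom F G -> dom_ideal I F -> dom_ideal I G.
Proof. by move=> FG IF a /IF aF; exact: dom_trans aF FG. Qed.

Lemma dom_product_ideal (a : R0 R) :
  product_ideal M L q a -> dom (eval2 a) (peval (bracket M L q)).
Proof.
suff : dom_ideal (product_ideal M L q) (fun z => \prod_j ifac j z ^+ M j).
  move=> H /H aD; apply: dom_trans aD _.
  by apply: dom_eq; exists 1 => // z _ _; rewrite peval_bracket.
rewrite /product_ideal; elim: (index_enum _) => [|j s IH].
  rewrite big_nil; apply: dom_ideal_le dom_idealT.
  by apply: dom_eq; exists 1 => // z _ _; rewrite big_nil.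
rewrite big_cons; apply: dom_ideal_le (dom_ideal_mul (F := fun z => ifac j z ^+ M j) _ IH).
  by apply: dom_eq; exists 1 => // z _ _; rewrite big_cons.
have q0 := puiseux_q0 hdata; have dq0 := puiseux_dq0 hdata.
elim: (M j) => [|m IHm].
  apply: dom_ideal_le dom_idealT.
  by apply: dom_eq; exists 1 => // z _ _; rewrite expr0.
rewrite /ideal_exp iterS; apply: dom_ideal_le (dom_ideal_mul (F := ifac j) _ IHm).
  by apply: dom_eq; exists 1 => // z _ _; rewrite exprS.
move=> _ [x [y ->]]; apply: dom_trans (dom_eq (eval2D _ _)) _.
have mul1 (g v : R0 R) : dom (eval2 g) (ifac j) -> dom (eval2 (v * g)) (ifac j).
  move=> gD; apply: dom_trans (dom_eq (eval2M _ _)) _.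
  have [A /dom_bounded vA] := eval2_bounded v.
  apply: dom_trans (domM vA gD) _.
  by apply: dom_eq; exists 1 => // z _ _; rewrite mul1r.
apply: domD; apply: mul1.
  apply: dom_trans (dom_segment (L j) (q0 j) (dq0 j) upper_i).
  by apply: dom_eq; exists 1 => // z _ _; rewrite eval2_poly peval_segment.
apply: dom_trans (dom_power_factor (L j) (q0 j) (dq0 j) upper_i).
by apply: dom_eq; exists 1 => // z _ _; rewrite eval2_poly pevalC hornerXn.
Qed.

End Comparison.

(** * Restriction to real curves *)

Section OrderOfVanishing.
Variable R : realType.
Local Notation C := R[i].
Implicit Types (G H : {poly C}) (F : {poly {poly C}}) (z : C * C).
Local Notation rc := (@real_to_complex_poly R).

(** Stands in for letting s tend to 0 from above, with the linear error that polynomials have at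
    0. *)
Lemma ler_limit0 (x y B d : R) : 0 < d ->
  (forall s, 0 < s < d -> x <= y + B * s) -> x <= y.
Proof.
move=> d0 H; apply/ler_addgt0Pr => e e0.
pose s := Num.min (d / 2) (e / (`|B| + 1)).
have B1 : 0 < `|B| + 1 by rewrite ltr_wpDl.
have s0 : 0 < s by rewrite lt_min !divr_gt0.
have sd : s < d by rewrite gt_min; apply/orP; left; lra.
have : s <= e / (`|B| + 1) by rewrite ge_min lexx orbT.
rewrite ler_pdivlMr // => se.
have {}H : x <= y + B * s by apply: H; rewrite s0.
have := ler_norm B; nra.
Qed.

Lemma poly_lipschitz0 G : exists2 B : R, 0 <= B &
  forall s, normc s <= 1 -> normc (G.[s] - G.[0]) <= B * normc s.
Proof.
have [h hE] := poly_split G; have [B B0 hB] := poly_bounded h.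
exists B => // s s1; rewrite hE !(hornerD, hornerM, hornerX, hornerC) mulr0 add0r addrK normcM.
by rewrite ler_wpM2r ?normc_ge0 // hB.
Qed.

Lemma normc_posr (s : R) : 0 < s -> normc s%:C%C = s.
Proof. by move=> s0; rewrite normc_real gtr0_norm. Qed.

Lemma horner0_le G H (K d : R) : 0 <= K -> 0 < d ->
  (forall s : R, 0 < s < d -> normc G.[s%:C%C] <= K * normc H.[s%:C%C]) ->
  normc G.[0] <= K * normc H.[0].
Proof.
move=> K0 d0 GH; have [B B0 GB] := poly_lipschitz0 G.
have [A A0 HA] := poly_lipschitz0 H.
apply: (@ler_limit0 _ _ (B + K * A) (Num.min 1 d)); first by rewrite lt_min ltr01.
move=> s; rewrite lt_min => /and3P[s0 s1 sd].
have ns := normc_posr s0; have s1' : normc s%:C%C <= 1 by rewrite ns ltW.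
have := GB _ s1'; rewrite normcB => h1; have := HA _ s1' => h2.
have h3 := GH s; rewrite s0 sd in h3; have {}h3 := h3 isT.
have h4 : normc G.[0] <= normc (G.[0] - G.[s%:C%C]) + normc G.[s%:C%C].
  by rewrite -{1}(subrK G.[s%:C%C] G.[0]) normcD.
have h5 : normc H.[s%:C%C] <= normc (H.[s%:C%C] - H.[0]) + normc H.[0].
  by rewrite -{1}(subrK H.[0] H.[s%:C%C]) normcD.
rewrite ns in h1 h2; have := ler_wpM2l K0 (le_trans h5 (lerD h2 (lexx _))); lra.
Qed.

(** Induction on D: for D > 0 the bound forces the constant term to vanish, and dividing by X lowers
    the exponent by one. *)
Lemma low_coef0 (D : nat) G (K d : R) : 0 < d ->
  (forall x : R, 0 < x < d -> normc G.[x%:C%C] <= K * x ^+ D) ->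
  forall n, (n < D)%N -> G`_n = 0.
Proof.
move=> d0; elim: D G => // D IH G GK.
have [h hE] := poly_split G.
have [B B0 GB] := poly_lipschitz0 G.
have c0 : G`_0 = 0.
  apply/eqP; rewrite -normc_eq0 eq_le normc_ge0 andbT -horner_coef0.
  apply: (@ler_limit0 _ _ (`|K| + B) (Num.min 1 d)); first by rewrite lt_min ltr01.
  move=> s; rewrite lt_min => /and3P[s0 s1 sd]; rewrite add0r.
  have ns := normc_posr s0; have := GB s%:C%C; rewrite ns normcB => /(_ (ltW s1)) h1.
  have h4 : normc G.[0] <= normc (G.[0] - G.[s%:C%C]) + normc G.[s%:C%C].
    by rewrite -{1}(subrK G.[s%:C%C] G.[0]) normcD.
  have : K * s ^+ D.+1 <= `|K| * s.
    apply: le_trans (ler_wpM2r _ (ler_norm K)) _; first by rewrite exprn_ge0 // ltW.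
    by rewrite ler_wpM2l // exprS ler_piMr ?exprn_ile1 // ltW.
  have := GK s; rewrite s0 sd => /(_ isT); lra.
rewrite hE c0 addr0 => -[|n] nD; first by rewrite coefMX.
rewrite coefMX /=; apply: IH nD => x /andP[x0 xd].
have := GK x; rewrite x0 xd => /(_ isT); rewrite {1}hE c0 addr0 !hornerE normcM.
by rewrite normc_posr // exprS mulrCA [normc _ * x]mulrC ler_pM2l.
Qed.

Lemma low_coef0_dvd (A : comNzRingType) (D : nat) (G : {poly A}) :
  (forall n, (n < D)%N -> G`_n = 0) -> exists h, G = h * 'X^D.
Proof.
move=> G0; exists (drop_poly D G); apply/polyP => n.
rewrite coefMXn; case: ltnP => nD; first exact: G0.
by rewrite coef_drop_poly subnK.
Qed.

Lemma peval_along F u v s :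
  (map_poly (comp_poly u) F).[v].[s] = peval F (u.[s], v.[s]) :> C.
Proof.
rewrite -[LHS]/(horner_eval s _) -horner_map /= /peval /=.
rewrite -[RHS]/(horner_eval u.[s] _) -horner_map /= -map_poly_comp /=.
rewrite /horner_eval hornerC; congr (_.[_]); apply: eq_map_poly => g /=.
by rewrite /horner_eval horner_comp.
Qed.

Lemma peval_curve F v s : F.[v].[s] = peval F (s, v.[s]) :> C.
Proof.
have := peval_along F 'X v s; rewrite hornerX => <-; congr (_.[_].[_]).
by rewrite map_poly_id // => g _; rewrite /= comp_polyXr.
Qed.

(* The part of F of degree d for the weights (1, e), dehomogenized at z1 = 1. *)
Definition weighted_part (e d : nat) F : {poly C} :=
  \poly_(b < size F) (if (e * b <= d)%N then F`_b`_(d - e * b) else 0).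

Lemma coef_curve F (e d : nat) (c : C) :
  (F.[c *: 'X^e])`_d = (weighted_part e d F).[c].
Proof.
rewrite horner_coef coef_sum horner_poly; apply: eq_bigr => b _.
rewrite exprZn -scalerAr coefZ -exprM coefMXn ltnNge mulrC.
by case: (e * b <= d)%N.
Qed.

Lemma coef_weighted_part F e d b :
  (weighted_part e d F)`_b = if (e * b <= d)%N then F`_b`_(d - e * b) else 0.
Proof.
rewrite coef_poly; case: ltnP => // sb; rewrite (nth_default _ sb) coef0.
by case: ifP.
Qed.

Lemma poly_posreal_eq0 G : (forall x : R, 0 < x -> G.[x%:C%C] = 0) -> G = 0.
Proof.
move=> G0; pose rs := [seq (n.+1%:R)%:C%C : C | n <- iota 0 (size G)].
apply: (@roots_geq_poly_eq0 _ G rs).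
- by apply/allP => _ /mapP[n _ ->]; rewrite rootE G0 // ltr0n.
- rewrite map_inj_uniq ?iota_uniq // => m n /complexI /eqP.
  by rewrite eqr_nat => /eqP [].
- by rewrite size_map size_iota.
Qed.

(** On y = l x^e the coefficient of x^d is a polynomial in l, the weighted part. It vanishes for all
    l > 0, hence identically, and its coefficients are coefficients of F. The constants K and d may
    therefore depend on l. *)
Lemma weighted_low_coef0 F (e D : nat) :
  (forall l : R, 0 < l -> exists K d : R, 0 < d /\ forall x : R, 0 < x < d ->
     normc (peval F (x%:C%C, (l * x ^+ e)%:C%C)) <= K * x ^+ D) ->
  forall a b, (a + e * b < D)%N -> F`_b`_a = 0.
Proof.
move=> FD a b abD.
have W0 : weighted_part e (a + e * b) F = 0.
  apply: poly_posreal_eq0 => l l0; rewrite -coef_curve.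
  have [K [d [d0 Kd]]] := FD l l0; apply: low_coef0 d0 _ _ abD => x xd.
  rewrite peval_curve !hornerE; move: (Kd x xd); congr (normc (peval F (_, _)) <= _).
  by rewrite rmorphM rmorphXn.
have := coef_weighted_part F e (a + e * b) b.
by rewrite W0 coef0 leq_addl addnK.
Qed.

(* Polynomials are continuous, so a bound on H^2 extends to (x, y) by letting s
   tend to 0 in (x + i s, y + i s). *)
Lemma dom_real_points (f g : {poly {poly C}}) : dom (peval f) (peval g) ->
  exists K d : R, [/\ 0 < K, 0 < d & forall x y : R, `|x| < d -> `|y| < d ->
    normc (peval f (x%:C%C, y%:C%C)) <= K * normc (peval g (x%:C%C, y%:C%C))].
Proof.
move=> [K K0 [d d0 dP]]; exists K, d; split=> // x y xd yd.
pose u (t : R) : {poly C} := t%:C%C%:P + 'i%C *: 'X.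
have uE t (s : R) : (u t).[s%:C%C] = (t +i* s)%C.
  rewrite /u !hornerE; apply/eqP; rewrite eq_complex /= !mul0r !mul1r.
  by rewrite !subr0 !addr0 !add0r !eqxx.
have uE0 t : (u t).[0] = t%:C%C by rewrite /u !hornerE.
pose al h := (map_poly (comp_poly (u x)) h).[u y].
have := @horner0_le (al f) (al g) K (Num.min (d - `|x|) (d - `|y|)) (ltW K0).
rewrite /al !peval_along !uE0; apply; first by rewrite lt_min !subr_gt0 xd.
move=> s; rewrite lt_min => /and3P[s0 sx sy]; rewrite !peval_along !uE.
have nn (t : R) : s < d - `|t| -> normc (t +i* s)%C < d.
  move=> st; apply: le_lt_trans (normc_le_ReIm _) _ => /=.
  by rewrite (gtr0_norm s0); lra.
by apply: dP; [exact: nn|exact: nn|split].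
Qed.

Lemma horner_rc (s : {poly R}) (x : R) : (rc s).[x%:C%C] = (s.[x])%:C%C.
Proof. by rewrite /real_to_complex_poly horner_map. Qed.

Lemma real_poly_bounded (s : {poly R}) :
  exists2 B : R, 0 <= B & forall x, `|x| <= 1 -> `|s.[x]| <= B.
Proof.
have [B B0 sB] := poly_bounded (rc s); exists B => // x x1.
by have := sB x%:C%C; rewrite horner_rc !normc_real; apply.
Qed.

Lemma real_poly_small (s : {poly R}) : s.[0] = 0 ->
  exists2 B : R, 0 <= B & forall x, `|x| <= 1 -> `|s.[x]| <= B * `|x|.
Proof.
have [h hE] := poly_split s; rewrite horner_coef0 => s0.
have [B B0 hB] := real_poly_bounded h; exists B => // x x1.
by rewrite hE s0 addr0 !hornerE normrM ler_wpM2r // hB.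
Qed.

End OrderOfVanishing.

(** * The product ideal *)

Section IdealClosure.
Variable A : comNzRingType.
Implicit Types (I J : set A) (a b g h : A).

Definition ideal_closed I :=
  [/\ I 0, forall a b, I a -> I b -> I (a + b) & forall a b, I b -> I (a * b)].

Lemma ideal_closedT : ideal_closed setT. Proof. by []. Qed.

Lemma ideal_mul_closed I J : ideal_closed J -> ideal_closed (ideal_mul I J).
Proof.
move=> [_ _ JM]; split.
- by exists 0%N, (fun=> 0), (fun=> 0); rewrite big_ord0; split=> // -[].
- move=> _ _ [m [a [b [ab ->]]]] [n [c [d [cd ->]]]].
  exists (m + n)%N, (fun i => match fintype.split i with inl i => a i | inr i => c i end),
    (fun i => match fintype.split i with inl i => b i | inr i => d i end); split.
    by move=> i; case: (fintype.split i) => j.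
  rewrite big_split_ord /=; congr (_ + _); apply: eq_bigr => i _.
    by rewrite -[lshift n i]/(unsplit (inl i)) unsplitK.
  by rewrite -[rshift m i]/(unsplit (inr i)) unsplitK.
- move=> r _ [m [a [b [ab ->]]]]; exists m, a, (fun i => r * b i); split.
    by move=> i; have [? ?] := ab i; split=> //; exact: JM.
  by rewrite mulr_sumr; apply: eq_bigr => i _; rewrite mulrCA.
Qed.

Lemma mem_ideal_mul I J a b : I a -> J b -> ideal_mul I J (a * b).
Proof. by exists 1%N, (fun=> a), (fun=> b); rewrite big_ord1. Qed.

Lemma mem_ideal_exp I g h m n : I g -> I h ->
  ideal_exp I (m + n) (g ^+ m * h ^+ n).
Proof.
move=> Ig Ih; elim: m => [|m IH].
  rewrite expr0 mul1r add0n; elim: n => // n IH.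
  by rewrite exprS; exact: mem_ideal_mul.
by rewrite exprS -mulrA; exact: mem_ideal_mul.
Qed.

Lemma mem_ideal_exp1 I g : I g -> ideal_exp I 1 g.
Proof. by move=> Ig; have := mem_ideal_exp 1 0 Ig Ig; rewrite mulr1. Qed.

Lemma ideal2_closed g h : ideal_closed (ideal2 g h).
Proof.
split; first by exists 0, 0; rewrite !mul0r addr0.
  move=> _ _ [a [b ->]] [c [d ->]]; exists (a + c), (b + d).
  by rewrite !mulrDl addrACA.
by move=> r _ [a [b ->]]; exists (r * a), (r * b); rewrite mulrDr !mulrA.
Qed.

Lemma ideal2_l g h : ideal2 g h g.
Proof. by exists 1, 0; rewrite mul1r mul0r addr0. Qed.

Lemma ideal2_r g h : ideal2 g h h.
Proof. by exists 0, 1; rewrite mul1r mul0r add0r. Qed.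

Lemma big_ideal_mul_closed (T : Type) (r : seq T) (F : T -> set A) :
  ideal_closed (\big[@ideal_mul A/setT]_(j <- r) F j).
Proof.
elim: r => [|j r IH]; first by rewrite big_nil.
by rewrite big_cons; exact: ideal_mul_closed.
Qed.

Lemma mem_big_ideal_mul (T : Type) (r : seq T) (F : T -> set A) (x : T -> A) :
  (forall j, F j (x j)) ->
  (\big[@ideal_mul A/setT]_(j <- r) F j) (\prod_(j <- r) x j).
Proof.
move=> Fx; elim: r => [|j r IH]; first by rewrite !big_nil.
by rewrite !big_cons; exact: mem_ideal_mul.
Qed.

End IdealClosure.

(* Greedy choice: drop a factor with the largest cutoff, which must be a power
   of the segment, until the exponent b is used up. *)
Lemma choose_cutoffs (I : finType) (m l : I -> nat) (a b : nat) :
  (forall e, (0 < e)%N -> (\sum_j m j * minn e (l j) <= a + e * b)%N) ->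
  exists c : I -> nat, [/\ forall j, (c j <= m j)%N,
    (\sum_j c j * l j <= a)%N & (\sum_j (m j - c j) <= b)%N].
Proof.
elim: b m => [|b IH] m mb.
  exists m; split=> //; last by rewrite big1 // => j _; rewrite subnn.
  (* For e beyond every cutoff each minimum is l j, and b = 0 removes e from the right side. *)
  have := mb (\sum_j l j).+1 isT; rewrite muln0 addn0; apply: leq_trans.
  apply: leq_sum => j _; rewrite (minn_idPr _) //.
  by apply: leqW; rewrite (bigD1 j) //= leq_addr.
case: (boolP [exists j, (0 < m j)%N]) => [/existsP[j0 m0]|]; last first.
  rewrite negb_exists => /forallP m0; exists m; split=> //.
    by rewrite big1 // => j _; have := m0 j; rewrite -eqn0Ngt => /eqP ->.
  by rewrite big1 // => j _; rewrite subnn.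
have [j mj jmax] := @arg_maxnP _ j0 (fun j => (0 < m j)%N) l m0.
pose m' i := (m i - (i == j))%N.
have mE (F : I -> nat) : (\sum_i m i * F i = \sum_i m' i * F i + F j)%N.
  rewrite (bigD1 j) //= [in RHS](bigD1 j) //= /m' eqxx.
  have -> : (m j * F j = (m j - 1) * F j + F j)%N.
    by rewrite -{1}(subnK mj) mulnDl mul1n.
  rewrite addnAC; congr (_ + _ + _)%N; apply: eq_bigr => i /negbTE ->.
  by rewrite subn0.
have [e e0|c [cm cl cb]] := IH m'.
  (* For e <= l j the dropped copy of j accounts for exactly e on both sides. Beyond l j, the
     largest cutoff still present, the left side stops growing, so the inequality at l j implies the
     one at e. *)
  case: (leqP e (l j)) => el.
    by have := mb e e0; rewrite mE (minn_idPl el) mulnS; lia.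
  have lmin : (\sum_i m' i * minn e (l i) <= \sum_i m' i * minn (l j) (l i))%N.
    apply: leq_sum => i _; case: (posnP (m i)) => [mi|/jmax /= li].
      by rewrite /m' mi.
    by rewrite leq_mul2l (minn_idPr li) (minn_idPr (leq_trans li (ltnW el))) leqnn orbT.
  apply: leq_trans lmin _; case: (posnP (l j)) => [->|lj].
    by rewrite big1 // => i _; rewrite min0n muln0.
  have := mb (l j) lj; rewrite mE minnn mulnS => h.
  have : (l j * b <= e * b)%N by rewrite leq_mul2r ltnW ?orbT.
  by lia.
exists c; split=> //.
  by move=> i; apply: leq_trans (cm i) _; rewrite leq_subr.
apply: leq_trans (_ : (\sum_i ((m' i - c i) + (i == j)) <= _)%N).
  by apply: leq_sum => i _; rewrite /m'; have := cm i; rewrite /m'; lia.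
rewrite big_split /= -(addn1 b) leq_add // (bigD1 j) //= eqxx big1 // => i /negbTE ->.
by [].
Qed.

Section ProductIdeal.
Variables (R : realType) (k : nat) (M L : 'I_k -> nat) (q : 'I_k -> {poly R}).
Local Notation C := R[i].
Local Notation rc := (@real_to_complex_poly R).
Implicit Types f g : {poly {poly C}}.

Definition in_ideal f := product_ideal M L q (R0_of_poly f).

Lemma product_ideal_closed : ideal_closed (product_ideal M L q).
Proof. exact: big_ideal_mul_closed. Qed.

Lemma in_idealD f g : in_ideal f -> in_ideal g -> in_ideal (f + g).
Proof. by have [_ D _] := product_ideal_closed; rewrite /in_ideal R0_of_polyD; exact: D. Qed.

Lemma in_idealMl f g : in_ideal g -> in_ideal (f * g).
Proof. by have [_ _ D] := product_ideal_closed; rewrite /in_ideal R0_of_polyM; exact: D. Qed.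

Lemma in_ideal0 : in_ideal 0.
Proof.
have [D _ _] := product_ideal_closed; move: D; rewrite /in_ideal; congr (product_ideal _ _ _ _).
have := R0_of_polyD (0 : {poly {poly C}}) 0; rewrite addr0 => /eqP.
by rewrite eq_sym -subr_eq0 addrK => /eqP ->.
Qed.

Lemma in_ideal_sum (T : Type) (r : seq T) (F : T -> {poly {poly C}}) :
  (forall i, in_ideal (F i)) -> in_ideal (\sum_(i <- r) F i).
Proof.
by move=> IF; elim/big_rec: _ => [|i x _ Ix]; [exact: in_ideal0|exact: in_idealD].
Qed.

Lemma R0_of_poly_prod (T : Type) (r : seq T) (F : T -> {poly {poly C}}) :
  R0_of_poly (\prod_(i <- r) F i) = \prod_(i <- r) R0_of_poly (F i).
Proof.
elim: r => [|i r IH]; first by rewrite !big_nil R0_of_poly1.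
by rewrite !big_cons R0_of_polyM IH.
Qed.

Lemma R0_of_polyXn f n : R0_of_poly (f ^+ n) = R0_of_poly f ^+ n.
Proof. by elim: n => [|n IH]; rewrite ?R0_of_poly1 // !exprS R0_of_polyM IH. Qed.

Lemma mem_product_ideal (F : 'I_k -> {poly {poly C}}) :
  (forall j, ideal_exp (ideal2 (R0_of_poly (segment (q j)))
     (R0_of_poly ('X^(2 * L j))%:P)) (M j) (R0_of_poly (F j))) ->
  in_ideal (\prod_j F j).
Proof. by rewrite /in_ideal R0_of_poly_prod; exact: mem_big_ideal_mul. Qed.

(** Allows denominators in z1 to be cleared: v is invertible in R0 though not in C[z1, z2]. *)
Lemma in_ideal_unit (v : {poly C}) f : v.[0] != 0 -> in_ideal (v%:P * f) -> in_ideal f.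
Proof.
move=> v0; have [y vy] : is_unit (R0_of_poly v%:P).
  by apply: R0_is_unit; rewrite /= coefC eqxx -horner_coef0.
have [_ _ D] := product_ideal_closed; rewrite /in_ideal R0_of_polyM => /(D y).
by rewrite mulrA (mulrC y) vy mul1r.
Qed.

(** The trace on R^2 of domination by [p]. The modulus of y + q_j(x) + i x^(2 L_j) is replaced by
    the sum of the moduli of its two parts, which is easier to estimate along curves. *)
Definition real_bound f := exists K d : R, [/\ 0 < K, 0 < d & forall x y : R,
  `|x| < d -> `|y| < d -> normc (peval f (x%:C%C, y%:C%C)) <=
    K * \prod_j (`|y + (q j).[x]| + `|x| ^+ (2 * L j)) ^+ M j].

Lemma real_bound_bracket x y :
  normc (peval (bracket M L q) (x%:C%C, y%:C%C)) <=
  \prod_j (`|y + (q j).[x]| + `|x| ^+ (2 * L j)) ^+ M j.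
Proof.
rewrite /bracket peval_prod normc_prod; apply: ler_prod => j _.
rewrite normc_ge0 /= pevalXn normcX.
apply: lerXn2r; rewrite ?nnegrE ?normc_ge0 ?addr_ge0 ?exprn_ge0 //.
rewrite pevalD peval_segment pevalC /= horner_rc !hornerE.
apply: le_trans (normcD _ _) _; rewrite -rmorphD normc_real lerD2l.
rewrite normcM normcX normc_real.
have -> : normc ('i%C : C) = 1 by rewrite /normc /= expr0n expr1n /= add0r sqrtr1.
by rewrite mul1r.
Qed.

Lemma bracket_lower x y :
  \prod_j `|y + (q j).[x]| ^+ M j <= normc (peval (bracket M L q) (x%:C%C, y%:C%C)).
Proof.
rewrite /bracket peval_prod normc_prod; apply: ler_prod => j _.
rewrite exprn_ge0 //= pevalXn normcX.
apply: lerXn2r; rewrite ?nnegrE ?normc_ge0 //.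
rewrite pevalD peval_segment pevalC /= horner_rc !hornerE -rmorphD -rmorphXn.
set w := (X in normc X); have -> : y + (q j).[x] = complex.Re w.
  by rewrite /= mul0r mul1r subr0 addr0.
exact: Re_le_normc.
Qed.

Lemma real_bound_of_dom f : dom (peval f) (peval (bracket M L q)) -> real_bound f.
Proof.
move=> /dom_real_points[K [d [K0 d0 Kd]]]; exists K, d; split=> // x y xd yd.
apply: le_trans (Kd x y xd yd) _; rewrite ler_wpM2l ?(ltW K0) //.
exact: real_bound_bracket.
Qed.

End ProductIdeal.

(** Used over A = C[z1]: the roots in z2 are the polynomials - q_j(z1). *)
Lemma root_prod_dvd (A : idomainType) (I : eqType) (a : I -> A) (T : {poly A})
  (s : seq I) : injective a -> uniq s -> (forall j, root T (a j)) ->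
  exists h, T = h * \prod_(j <- s) ('X - (a j)%:P).
Proof.
move=> ainj + Ta; elim: s => [_|j s IH /= /andP[js us]].
  by exists T; rewrite big_nil mulr1.
have [h hE] := IH us; have := Ta j; rewrite hE rootM => /orP[|].
  by move=> /factor_theorem[g gE]; exists g; rewrite big_cons mulrA -gE.
rewrite -(big_map a xpredT (fun x => 'X - x%:P)) root_prod_XsubC.
have -> : (a j \in [seq a i | i <- s]) = false by rewrite mem_map // (negbTE js).
by [].
Qed.

(** * Membership from the real bound: one common segment, or separated segments *)

Section Cases.
Variables (R : realType) (k : nat) (M L : 'I_k -> nat) (q : 'I_k -> {poly R}).
Local Notation C := R[i].
Local Notation rc := (@real_to_complex_poly R).
Implicit Types f g : {poly {poly C}}.
Local Notation in_ideal := (in_ideal M L q).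
Local Notation real_bound := (real_bound M L q).

Lemma curve_bound f (v : {poly R}) (n : 'I_k -> nat) : real_bound f -> v.[0] = 0 ->
  (forall j, exists B : R, forall x, 0 < x < 1 ->
     `|v.[x] + (q j).[x]| + x ^+ (2 * L j) <= B * x ^+ n j) ->
  exists K d : R, 0 < d /\ forall x : R, 0 < x < d ->
    normc (peval f (x%:C%C, v.[x]%:C%C)) <= K * x ^+ (\sum_j M j * n j).
Proof.
move=> [K [d [K0 d0 Kd]]] v0 /boolp.choice[B BP].
have [A A0 vA] := real_poly_small v0.
(* On this range |v(x)| <= A x < d, so the curve stays where the bound on f holds. *)
exists (K * \prod_j B j ^+ M j), (Num.min (Num.min 1 d) (d / (A + 1))); split.
  by rewrite !lt_min ltr01 d0 divr_gt0 // ltr_wpDl.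
move=> x; rewrite !lt_min => /and3P[x0 /andP[x1 xd]].
rewrite ltr_pdivlMr ?ltr_wpDl // => xA.
have nx : `|x| = x by rewrite gtr0_norm.
have x1' : `|x| <= 1 by rewrite nx ltW.
apply: le_trans (Kd x v.[x] _ _) _; rewrite ?nx //.
  by apply: le_lt_trans (vA x x1') _; rewrite nx; lra.
rewrite -mulrA ler_wpM2l ?(ltW K0) // -prodrXr -big_split /=.
apply: ler_prod => j _; rewrite exprn_ge0 ?addr_ge0 ?exprn_ge0 ?(ltW x0) //=.
rewrite (mulnC (M j)) (exprM x (n j)) -exprMn; have h := BP j x; rewrite x0 x1 in h.
have h1 : 0 <= `|v.[x] + (q j).[x]| + x ^+ (2 * L j).
  by rewrite addr_ge0 ?exprn_ge0 ?(ltW x0).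
by apply: lerXn2r; rewrite ?nnegrE //; [exact: le_trans h1 (h isT)|exact: h].
Qed.

Lemma expr_min (x : R) m n : 0 < x < 1 -> (m <= n)%N -> x ^+ n <= x ^+ m.
Proof. by move=> /andP[x0 x1]; apply: expr_anti; rewrite !ltW. Qed.

Lemma peval_comp f v z : peval (f \Po v) z = peval f (z.1, peval v z) :> C.
Proof. by rewrite [LHS]/peval horner_comp peval_curve. Qed.

Lemma comp_segment f (q0 : {poly R}) :
  (f \Po ('X - (rc q0)%:P)) \Po segment q0 = f.
Proof.
rewrite -comp_polyA comp_polyB comp_polyX comp_polyC /segment addrK.
exact: comp_polyXr.
Qed.

(** Changing q j modulo z1^(2 L j) does not change the ideal of factor j, so every factor may be
    written with w = z2 + q0. F is f in the coordinates (z1, w), and membership is checked monomial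
    by monomial. *)
Lemma repeated_case f (q0 : {poly R}) : q0.[0] = 0 ->
  (forall j, exists h, q j = q0 + h * 'X^(2 * L j)) -> real_bound f -> in_ideal f.
Proof.
move=> q00 /boolp.choice[h qh] fb.
pose F := f \Po ('X - (rc q0)%:P).
rewrite -(comp_segment f q0) -/F comp_polyE; apply: in_ideal_sum => b.
rewrite -mul_polyC -[F`_b]coefK poly_def rmorph_sum mulr_suml.
apply: in_ideal_sum => a; rewrite -mul_polyC rmorphM -mulrA /=.
have [->|Fab] := eqVneq (F`_b`_a) 0; first by rewrite mul0r; exact: in_ideal0.
apply: in_idealMl.
(* If the inequality failed at e, then on w = l x^e, where factor j is O(x^min(e, 2 L j)), f would
   vanish to order greater than a + e b, and the coefficient of z1^a w^b would be 0. *)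
have [e e0|c [cM cL cb]] := @choose_cutoffs _ M (fun j => 2 * L j)%N a b.
  rewrite leqNgt; apply/negP => ab; move/eqP: Fab; apply.
  apply: weighted_low_coef0 ab => l l0.
  pose v : {poly R} := l *: 'X^e - q0.
  have [||K [d [d0 Kd]]] := @curve_bound f v (fun j => minn e (2 * L j)) fb.
  - by rewrite /v !hornerE q00 expr0n gtn_eqF // mulr0 subrr.
  - move=> j; have [B B0 hB] := real_poly_bounded (h j).
    exists (l + B + 1) => x x01; have /andP[x0 x1] := x01.
    rewrite qh /v !(hornerD, hornerN, hornerZ, hornerM, hornerXn).
    have -> : l * x ^+ e - q0.[x] + (q0.[x] + (h j).[x] * x ^+ (2 * L j)) =
      l * x ^+ e + (h j).[x] * x ^+ (2 * L j) by ring.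
    have m1 := expr_min x01 (geq_minl e (2 * L j)).
    have m2 := expr_min x01 (geq_minr e (2 * L j)).
    have x2 : 0 <= x ^+ (2 * L j) by rewrite exprn_ge0 // ltW.
    have xe : 0 <= x ^+ e by rewrite exprn_ge0 // ltW.
    rewrite !mulrDl mul1r; apply: lerD => //.
    apply: le_trans (ler_normD _ _) _; rewrite !normrM (gtr0_norm l0) (ger0_norm x2) (ger0_norm xe).
    apply: lerD; first by rewrite ler_wpM2l // ltW.
    by apply: ler_pM => //; apply: hB; rewrite gtr0_norm ?ltW.
  exists K, d; split=> // x xd; move: (Kd x xd).
  rewrite /F peval_comp pevalD pevalX pevalN pevalC /= horner_rc.
  by rewrite /v !hornerE -rmorphB.
pose W := segment q0.
(* Copy by copy, c j of the M j copies of factor j receive z1^(2 L j) and the others receive w; the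
   unspent powers of z1 and w are collected in front. *)
have -> : 'X^a%:P * W ^+ b = 'X^(a - \sum_j c j * (2 * L j))%:P *
    W ^+ (b - \sum_j (M j - c j)) *
    \prod_j ('X^(2 * L j)%:P ^+ c j * W ^+ (M j - c j)).
  rewrite big_split /= prodrXr mulrACA -exprD subnK //.
  have -> : \prod_j 'X^(2 * L j)%:P ^+ c j = 'X^(\sum_j c j * (2 * L j))%:P :> {poly {poly C}}.
    rewrite -prodrXr rmorph_prod; apply: eq_bigr => j _.
    by rewrite -rmorphXn -exprM mulnC.
  by rewrite -rmorphM -exprD subnK.
apply: in_idealMl; apply: mem_product_ideal => j.
rewrite R0_of_polyM !R0_of_polyXn -{1}(subnKC (cM j)); apply: mem_ideal_exp.
  exact: ideal2_r.
have -> : W = segment (q j) + (- (rc (h j)))%:P * 'X^(2 * L j)%:P.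
  rewrite /W /segment qh /real_to_complex_poly !(rmorphD, rmorphM) /= map_polyXn.
  by rewrite polyCN; ring.
have [_ D E] := @ideal2_closed _ (R0_of_poly (segment (q j))) (R0_of_poly ('X^(2 * L j))%:P).
by rewrite R0_of_polyD R0_of_polyM; apply: D; [exact: ideal2_l|exact/E/ideal2_r].
Qed.

Lemma horner_rc0 (s : {poly R}) : (rc s).[0] = (s.[0])%:C%C.
Proof. by rewrite -(horner_rc s 0). Qed.

(* v i j is a unit at 0; clearing these denominators keeps the correction terms S
   polynomial, at the cost of the unit Vt. *)
Lemma separated_case f (v : 'I_k -> 'I_k -> {poly R}) (r : 'I_k -> 'I_k -> nat) :
  (forall j, M j = 1%N) -> (forall j, (q j).[0] = 0) ->
  (forall i j, i != j -> [/\ q i - q j = v i j * 'X^(r i j), (v i j).[0] != 0 &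
     (r i j <= 2 * L i)%N]) -> real_bound f -> in_ideal f.
Proof.
move=> M1 q0 vP fb.
pose V j := \prod_(i | i != j) rc (v i j).
pose s j := (\sum_(i | i != j) r i j)%N.
have /boolp.choice[g gP] : forall j, exists g : {poly C},
    f.[- rc (q j)] = g * 'X^(2 * L j + s j).
  move=> j; apply: low_coef0_dvd.
  (* On segment j, factor j keeps only x^(2 L j), while factor i has the contact order r i j, which
     does not exceed its cutoff. *)
  pose n i := if i == j then (2 * L j)%N else r i j.
  have [||K [d [d0 Kd]]] := @curve_bound f (- q j) n fb.
  - by rewrite hornerN q0 oppr0.
  - move=> i; rewrite /n; case: (eqVneq i j) => [->|ij].
      by exists 1 => x _; rewrite hornerN addNr normr0 add0r mul1r.
    have [vE _ rL] := vP i j ij; have [B B0 vB] := real_poly_bounded (v i j).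
    exists (B + 1) => x x01; have /andP[x0 x1] := x01.
    rewrite hornerN.
    have -> : - (q j).[x] + (q i).[x] = (v i j).[x] * x ^+ r i j.
      by rewrite addrC -hornerN -hornerD vE hornerM hornerXn.
    rewrite normrM mulrDl mul1r; apply: lerD; last exact: expr_min.
    have xr : 0 <= x ^+ r i j by rewrite exprn_ge0 // ltW.
    by rewrite (ger0_norm xr) ler_wpM2r // vB // gtr0_norm ?ltW.
  have nE : (\sum_i M i * n i = 2 * L j + s j)%N.
    rewrite (bigD1 j) //= /n eqxx M1 mul1n; congr addn; apply: eq_bigr => i ij.
    by rewrite M1 mul1n (negbTE ij).
  rewrite -nE; apply: (low_coef0 d0) => x xd.
  move: (Kd x xd); rewrite peval_curve !hornerN horner_rc -rmorphN; exact.
pose w j := segment (q j).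
(* Chosen so that S and Vt f agree on z2 = - q j: there the other segments multiply to V j z1^(s j),
   f is g j z1^(2 L j + s j), and Vt is V j times the remaining V i. *)
pose cf j := 'X^(2 * L j) * g j * \prod_(i | i != j) V i.
pose Vt := \prod_j V j.
pose S := \sum_j (cf j)%:P * \prod_(i | i != j) w i.
have wE i j : (w i).[- rc (q j)] = rc (q i - q j).
  by rewrite /w /segment !hornerE addrC /real_to_complex_poly rmorphB.
have aI : injective (fun j => - rc (q j)).
  move=> i j /oppr_inj /(map_poly_inj (real_complex R)) qij.
  apply/eqP/negPn/negP => /vP[]; rewrite qij subrr => /esym /eqP.
  by rewrite mulf_eq0 -[_ ^+ _ == 0](@size_poly_eq0 R) size_polyXn orbF => /eqP ->;
    rewrite horner0 eqxx.
have Troot j : root (Vt%:P * f - S) (- rc (q j)).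
  rewrite rootE hornerD hornerN hornerM hornerC gP /S horner_sum (bigD1 j) //=.
  rewrite [X in - (_ + X)]big1 ?addr0 => [|i ij]; last first.
    (* The summand of index i <> j contains the segment w j, which vanishes here. *)
    rewrite hornerM horner_prod (bigD1 j) 1?eq_sym //= wE subrr.
    by rewrite /real_to_complex_poly rmorph0 mul0r mulr0.
  rewrite hornerM hornerC horner_prod.
  have -> : \prod_(i | i != j) (w i).[- rc (q j)] = V j * 'X^(s j).
    rewrite /V /s -prodrXr -big_split /=; apply: eq_bigr => i ij.
    have [vE _ _] := vP i j ij.
    by rewrite wE vE /real_to_complex_poly rmorphM /= map_polyXn.
  rewrite /Vt /cf (bigD1 j) //= exprD subr_eq0; apply/eqP; ring.
have [h hE] := root_prod_dvd aI (index_enum_uniq _) Troot.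
apply: (@in_ideal_unit _ _ _ _ _ Vt).
  rewrite /Vt horner_prod; apply/prodf_neq0 => j _.
  rewrite /V horner_prod; apply/prodf_neq0 => i ij; have [_ v0 _] := vP i j ij.
  by rewrite horner_rc0 -(rmorph0 (real_complex R)) (inj_eq (@complexI R)).
have -> : Vt%:P * f = h * \prod_j w j + S.
  rewrite -[LHS](subrK S) hE; congr (_ * _ + _); apply: eq_bigr => j _.
  by rewrite /w /segment polyCN opprK.
apply: in_idealD; first apply: in_idealMl.
  by apply: mem_product_ideal => j; rewrite M1; exact/mem_ideal_exp1/ideal2_l.
apply: in_ideal_sum => j.
(* In this summand z1^(2 L j) takes the place of the missing segment w j, so every factor of the
   product ideal has a generator. *)
have -> : (cf j)%:P * \prod_(i | i != j) w i = (g j * \prod_(i | i != j) V i)%:P *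
    \prod_i (if i == j then 'X^(2 * L j)%:P else w i).
  rewrite [X in _ = _ * X](bigD1 j) //= eqxx mulrA -rmorphM; congr (_%:P * _).
    by rewrite /cf; ring.
  by apply: eq_bigr => i /negbTE ->.
apply: in_idealMl; apply: mem_product_ideal => i; rewrite M1; apply: mem_ideal_exp1.
by case: eqP => [->|_]; [exact: ideal2_r|exact: ideal2_l].
Qed.

End Cases.

(** * Multiplicities and tangents *)

Section OrderAndTangents.
Variables (R : realType) (p : {poly {poly R[i]}}).
Variables (k : nat) (M L : 'I_k -> nat) (q : 'I_k -> {poly R}).
Variable psi : 'I_k -> fps R[i].
Hypothesis hdata : puiseux_data p M L q psi.
Local Notation C := R[i].
Local Notation rc := (@real_to_complex_poly R).
Local Notation slope j := ((q j)`_1).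

Let q0 := puiseux_q0 hdata.

Lemma cutoff_ge1 j : (1 <= 2 * L j)%N.
Proof. by rewrite muln_gt0 (puiseux_L_gt0 hdata j). Qed.

Lemma real_bound_p : real_bound M L q p.
Proof. by apply: real_bound_of_dom; have [] := dom_p_bracket hdata. Qed.

Lemma segment_tangent j : exists2 B : R, 0 <= B & forall x, `|x| <= 1 ->
  `|(q j).[x] - slope j * x| <= B * x ^+ 2.
Proof.
have low n : (n < 2)%N -> (q j - slope j *: 'X)`_n = 0.
  case: n => [|[|]] // _; rewrite coefB coefZ coefX ?mulr0 ?mulr1 ?subrr //.
  by rewrite subr0 -horner_coef0 q0.
have [h hE] := low_coef0_dvd low.
have [B B0 hB] := real_poly_bounded h; exists B => // x x1.
have -> : (q j).[x] - slope j * x = h.[x] * x ^+ 2.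
  by rewrite -(hornerXn x 2) -hornerM -hE !hornerE.
by rewrite normrM (ger0_norm (sqr_ge0 x)) ler_wpM2r ?sqr_ge0 // hB.
Qed.

Lemma line_bound (l : R) : exists B : 'I_k -> R, forall j,
  [/\ 0 <= B j & forall x, 0 < x < 1 ->
  `|l * x + (q j).[x]| + x ^+ (2 * L j) <= (`|l + slope j| + B j * x) * x].
Proof.
suff: forall j, exists b : R, 0 <= b /\ forall x, 0 < x < 1 ->
  `|l * x + (q j).[x]| + x ^+ (2 * L j) <= (`|l + slope j| + b * x) * x.
  by move=> /boolp.choice[B BP]; exists B.
move=> j.
have [B B0 BP] := segment_tangent j.
exists (B + 1); split=> [|x x01]; first exact: addr_ge0.
have /andP[x0 x1] := x01; have xx : `|x| <= 1 by rewrite gtr0_norm ?ltW.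
have -> : l * x + (q j).[x] = (l + slope j) * x + ((q j).[x] - slope j * x) by ring.
have := ler_normD ((l + slope j) * x) ((q j).[x] - slope j * x).
rewrite normrM (gtr0_norm x0); have := BP x xx.
have L2 : (2 <= 2 * L j)%N by have := puiseux_L_gt0 hdata j; lia.
have := expr_min x01 L2; rewrite expr2; nra.
Qed.

Lemma coef_below_order0 a b : (a + b < \sum_j M j)%N -> p`_b`_a = 0.
Proof.
rewrite -{1}(mul1n b); apply: weighted_low_coef0 => l l0.
have [B BP] := line_bound l.
have [||K [d [d0 Kd]]] := @curve_bound _ _ M L q p (l *: 'X) (fun=> 1%N) real_bound_p.
- by rewrite !hornerE.
- move=> j; have [B0 {}BP] := BP j; exists (`|l + slope j| + B j) => x x01.
  have /andP[x0 x1] := x01; rewrite !hornerE; apply: le_trans (BP x x01) _.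
  by rewrite expr1 ler_wpM2r ?(ltW x0) // lerD2l ler_piMr // ltW.
exists K, d; split=> // x xd; have := Kd x xd; rewrite !hornerE.
by under eq_bigr => j _ do rewrite muln1.
Qed.

Lemma line_restriction_dvd n (l : C) : (forall a b, (a + b < n)%N -> p`_b`_a = 0) ->
  exists h, p.[l *: 'X^1] = h * 'X^n.
Proof.
move=> plow; apply: low_coef0_dvd => m mn; rewrite coef_curve.
rewrite (_ : weighted_part _ _ _ = 0) ?horner0 //; apply/polyP => i.
rewrite coef_weighted_part coef0 mul1n; case: leqP => // im.
by rewrite plow // subnK.
Qed.

(** The order can be read from sizes on lines through 0. The upper bound of |p| by [p] gives order
    at least N = sum_j M j, which is [coef_below_order0]; the lower bound excludes a larger
    order. *)
Lemma order_sum n : vanishes_to_order p n -> n = (\sum_j M j)%N.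
Proof.
move=> [plow [a [b [abn pab]]]]; apply/eqP; rewrite eqn_leq; apply/andP; split.
  rewrite leqNgt; apply/negP => Nn.
  have [K [d [K0 d0 Kd]]] := dom_real_points (proj2 (dom_p_bracket hdata)).
  have /boolp.choice[B BP] : forall j, exists B : R,
      0 <= B /\ forall x, `|x| <= 1 -> `|(q j).[x]| <= B * `|x|.
    by move=> j; have [B B0 HB] := real_poly_small (q0 j); exists B.
  (* Steep enough that every segment y + q_j(x) is at least x on y = l x, since |q_j(x)| <= B j x.
     Then [p] is at least x^N there, while p is O(x^n) with N < n. *)
  pose l := 1 + \sum_j B j.
  have sB0 : 0 <= \sum_j B j by apply: sumr_ge0 => j _; have [] := BP j.
  have l0 : 0 < l by rewrite ltr_pwDl.
  have [h hE] := line_restriction_dvd l%:C%C plow.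
  have [A A0 hA] := poly_bounded h.
  have xN : ('X^(\sum_j M j)%N : {poly C})`_(\sum_j M j) = 0.
    apply: (@low_coef0 _ n _ (K * A) (Num.min 1 (d / (l + 1)))) => //.
      by rewrite lt_min ltr01 divr_gt0 // ltr_wpDl // ltW.
    move=> x; rewrite lt_min ltr_pdivlMr; last by rewrite ltr_wpDl // ltW.
    move=> /and3P[x0 x1 xd]; have x1' : `|x| <= 1 by rewrite gtr0_norm ?ltW.
    have xd' : `|x| < d by rewrite gtr0_norm //; nra.
    have lxd : `|l * x| < d by rewrite gtr0_norm ?mulr_gt0 //; lra.
    rewrite hornerXn normcX normc_posr //.
    have -> : K * A * x ^+ n = K * (A * normc (x%:C%C ^+ n)).
      by rewrite normcX normc_posr // mulrA.
    have := le_trans (bracket_lower M L q x (l * x)) (Kd _ _ xd' lxd).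
    have pE := peval_curve p (l%:C%C *: 'X^1) x%:C%C; rewrite hE !hornerE in pE.
    rewrite rmorphM -pE normcM => H.
    have H' : K * (normc h.[x%:C%C] * normc (x%:C%C ^+ n)) <= K * (A * normc (x%:C%C ^+ n)).
      rewrite ler_wpM2l ?(ltW K0) // ler_wpM2r ?normc_ge0 //.
      by apply: hA; rewrite normc_posr // ltW.
    apply: le_trans (le_trans H H').
    rewrite -prodrXr; apply: ler_prod => j _; rewrite exprn_ge0 ?(ltW x0) //=.
    apply: lerXn2r; rewrite ?nnegrE ?(ltW x0) //.
    have [Bj0 /(_ x x1')] := BP j; rewrite (gtr0_norm x0) => qB.
    have lB : 1 + B j <= l.
      rewrite lerD2l (bigD1 j) //= lerDl; apply: sumr_ge0 => i _.
      by have [] := BP i.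
    apply: le_trans (ler_norm _); move: qB; rewrite ler_norml => /andP[qB _].
    by have := ler_wpM2r (ltW x0) lB; lra.
  by move/eqP: xN; rewrite coefXn eqxx oner_eq0.
by rewrite leqNgt; apply/negP => nN; apply: pab; rewrite coef_below_order0 // abn.
Qed.

(** On y = l x the bound for p is divided by x^N, N being the order, and x tends to 0. The
    polynomial H majorizes the divided right side, so [horner0_le] takes the limit. *)
Lemma tangent_bound : exists K : R, 0 <= K /\ forall l : R,
  normc (weighted_part 1 (\sum_j M j) p).[l%:C%C]
    <= K * \prod_j `|l + slope j| ^+ M j.
Proof.
have [K [d [K0 d0 Kd]]] := real_bound_p; exists K; split=> [|l]; first exact: ltW.
set N := (\sum_j M j)%N.
have [h hE] := line_restriction_dvd l%:C%C coef_below_order0; rewrite -/N in hE.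
have [B BP] := line_bound l.
pose H := \prod_j ((`|l + slope j|)%:C%C%:P + (B j)%:C%C *: 'X) ^+ M j : {poly C}.
have HE (x : R) : H.[x%:C%C] = (\prod_j (`|l + slope j| + B j * x) ^+ M j)%:C%C.
  rewrite /H horner_prod rmorph_prod; apply: eq_bigr => j _.
  by rewrite horner_exp !hornerE rmorphXn rmorphD rmorphM.
have -> : (weighted_part 1 N p).[l%:C%C] = h.[0].
  by rewrite -coef_curve hE coefMXn ltnn subnn horner_coef0.
have H0 : normc H.[0] = \prod_j `|l + slope j| ^+ M j.
  have H0 := HE 0; rewrite rmorph0 in H0; rewrite H0 normc_real ger0_norm.
    by apply: eq_bigr => j _; rewrite mulr0 addr0.
  by apply: prodr_ge0 => j _; rewrite mulr0 addr0 exprn_ge0.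
have := @horner0_le _ h H K (Num.min 1 (d / (`|l| + 1))) (ltW K0).
rewrite H0; apply; first by rewrite lt_min ltr01 divr_gt0 // ltr_wpDl.
move=> x; rewrite lt_min ltr_pdivlMr ?ltr_wpDl // => /and3P[x0 x1 xd].
have xx : `|x| = x by rewrite gtr0_norm.
have xd' : `|x| < d by rewrite xx; have := normr_ge0 l; nra.
have lxd : `|l * x| < d by rewrite normrM xx; nra.
have pE := peval_curve p (l%:C%C *: 'X^1) x%:C%C; rewrite hE !hornerE in pE.
have := Kd x (l * x) xd' lxd; rewrite rmorphM -pE normcM normcX normc_posr // xx => hK.
have xN : 0 < x ^+ N by rewrite exprn_gt0.
have x01 : 0 < x < 1 by rewrite x0.
rewrite -(ler_pM2r xN); apply: le_trans hK _; rewrite -mulrA ler_wpM2l ?(ltW K0) //.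
have pos j : 0 <= `|l + slope j| + B j * x.
  by have [B0 _] := BP j; rewrite addr_ge0 // mulr_ge0 // ltW.
rewrite HE normc_real ger0_norm; last first.
  by apply: prodr_ge0 => j _; rewrite exprn_ge0.
rewrite /N -prodrXr -big_split /=; apply: ler_prod => j _.
have s0 : 0 <= `|l * x + (q j).[x]| + x ^+ (2 * L j).
  by rewrite addr_ge0 // exprn_ge0 // ltW.
rewrite exprn_ge0 //= -exprMn; have [_ /(_ x x01) le] := BP j.
by apply: lerXn2r; rewrite ?nnegrE //; exact: le_trans le.
Qed.

Lemma dehomogenize n :
  weighted_part 1 n p = map_poly (horner_eval (1 : C)) (homogeneous_part p n).
Proof.
apply/polyP => b; rewrite coef_weighted_part coef_map coef_sum mul1n /=.
rewrite /horner_eval horner_sum.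
have E (i : 'I_n.+1) : (((p`_(n - i)`_i *: 'X^i)%:P * 'X^(n - i))`_b).[1] =
    if (b == n - i)%N then p`_b`_(n - b) else 0.
  rewrite coefCM coefXn; case: eqP => [->|_]; last by rewrite mulr0 horner0.
  by rewrite mulr1 !hornerE expr1n mulr1 subKn // -ltnS.
rewrite (eq_bigr _ (fun i _ => E i)) -big_mkcond /=; case: leqP => bn.
  have lt : (n - b < n.+1)%N by rewrite ltnS leq_subr.
  rewrite (big_pred1 (Ordinal lt)) // => i; rewrite /= -val_eqE /=.
  by apply/eqP/eqP => ->; rewrite subKn // -ltnS.
by rewrite big_pred0 // => i; apply/eqP => bE; move: bn; rewrite bE ltnNge leq_subr.
Qed.

(* A slope of multiplicity at least 2 makes the tangent polynomial vanish to
   order 2 at - slope, by tangent_bound, whereas distinct linear forms give it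
   only simple zeros. *)
Lemma tangent_simple n (a b : 'I_n -> C) (l0 : R) : vanishes_to_order p n ->
  homogeneous_part p n = \prod_(i < n) linear_form (a i) (b i) ->
  (forall i j, i != j -> forall c : C,
     linear_form (a i) (b i) <> c%:P%:P * linear_form (a j) (b j)) ->
  (\sum_j (if (l0 + slope j == 0)%R then M j else 0) <= 1)%N.
Proof.
move=> pn homE nprop; rewrite leqNgt; apply/negP; set D := (\sum_j _)%N => D2.
set P := weighted_part 1 n p.
have [K [K0 KP]] := tangent_bound; rewrite -(order_sum pn) -/P in KP.
(* P recentred at l0. The branches with slope - l0 contribute s^(M j) to the tangent bound, so Q is
   O(s^D) with D >= 2. *)
pose Q := P \Po ('X + l0%:C%C%:P).
have Q0 m : (m < 2)%N -> Q`_m = 0.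
  move=> m2; pose B j := `|l0 + slope j| + 1.
  apply: (@low_coef0 _ D Q (K * \prod_j B j ^+ M j) 1 ltr01 _ m (leq_trans m2 D2)).
  move=> s s01; have /andP[s0 s1] := s01.
  rewrite horner_comp !hornerE -rmorphD; apply: le_trans (KP _) _.
  rewrite -mulrA ler_wpM2l // /D -prodrXr -big_split /=; apply: ler_prod => j _.
  rewrite exprn_ge0 //=; have B1 : 1 <= B j by rewrite lerDr.
  have -> : s + l0 + slope j = s + (l0 + slope j) by rewrite addrA.
  case: ifP => [/eqP ->|_].
    rewrite addr0 gtr0_norm // ler_peMl ?exprn_ge0 ?(ltW s0) //.
    by rewrite exprn_ege1.
  rewrite expr0 mulr1; apply: lerXn2r; rewrite ?nnegrE //; first by rewrite addr_ge0.
  by apply: le_trans (ler_normD _ _) _; rewrite gtr0_norm // addrC lerD2l ltW.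
(* The value of the i-th linear form at (1, l0), hence the constant term of the i-th factor of Q. *)
pose c i := a i + b i * l0%:C%C.
have PE : P = \prod_i ((a i)%:P + b i *: 'X).
  rewrite /P dehomogenize homE rmorph_prod; apply: eq_bigr => i _.
  rewrite /linear_form rmorphD rmorphM /= !map_polyC map_polyX /= /horner_eval.
  by rewrite !hornerE mul_polyC.
have QE : Q = \prod_i ((c i)%:P + b i *: 'X).
  rewrite /Q PE rmorph_prod; apply: eq_bigr => i _ /=.
  rewrite comp_polyD comp_polyC comp_polyZ comp_polyX /c scalerDr -!mul_polyC.
  rewrite rmorphD rmorphM /=; ring.
have P0 : P != 0.
  have [_ [i [j [ijn pij]]]] := pn; apply/eqP => P0; apply: pij.
  have := coef_weighted_part p 1 n j; rewrite -/P P0 coef0 mul1n -ijn leq_addl addnK.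
  exact: esym.
have [i0 ci0] : exists i, c i = 0.
  have : \prod_i c i = 0.
    rewrite -(Q0 0%N isT) -horner_coef0 QE horner_prod; apply: eq_bigr => i _.
    by rewrite hornerD hornerC hornerZ hornerX mulr0 addr0.
  by move/eqP/prodf_eq0 => [i _ /eqP ci]; exists i.
have : b i0 * \prod_(i | i != i0) c i = 0.
  rewrite -(Q0 1%N isT) QE [in RHS](bigD1 i0) //= ci0 add0r -scalerAl coefZ coefXM /=.
  congr (_ * _); rewrite -horner_coef0 horner_prod; apply: eq_bigr => i _.
  by rewrite hornerD hornerC hornerZ hornerX mulr0 addr0.
have formE i : c i = 0 -> a i = - (b i * l0%:C%C) by move/eqP; rewrite addr_eq0 => /eqP.
(* Either form i0 is zero, which would make P zero, or a second form i1 also vanishes at (1, l0) and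
   the two are proportional. *)
move=> /eqP; rewrite mulf_eq0 => /orP[/eqP bi|/prodf_eq0[i1 i10 /eqP ci1]].
  move/eqP: P0; apply; rewrite PE (bigD1 i0) //= bi scale0r addr0.
  by rewrite formE // bi mul0r oppr0 mul0r.
have [bi1|bi1] := eqVneq (b i1) 0.
  apply: (nprop i1 i0 i10 0); rewrite mul0r /linear_form formE // bi1.
  by rewrite mul0r oppr0 scale0r !mul0r addr0.
apply: (nprop i0 i1 _ (b i0 / b i1)); first by rewrite eq_sym.
rewrite /linear_form !formE // mulrDr mulrA -!rmorphM mulfVK //; congr (_%:P + _).
by rewrite mul_polyC scalerA mulrN mulrA mulfVK.
Qed.

(** At l0 = - slope j the count of [tangent_simple] contains M j, and also M i for any other branch
    i of the same slope; each is positive and the total is at most 1. *)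
Lemma ordinary_simple_branches n (a b : 'I_n -> C) : vanishes_to_order p n ->
  homogeneous_part p n = \prod_(i < n) linear_form (a i) (b i) ->
  (forall i j, i != j -> forall c : C,
     linear_form (a i) (b i) <> c%:P%:P * linear_form (a j) (b j)) ->
  (forall j, M j = 1%N) /\ (forall i j, i != j -> slope i != slope j).
Proof.
move=> pn homE nprop; have ts l0 := tangent_simple l0 pn homE nprop.
have M0 := puiseux_M_gt0 hdata; split=> [j|i j ij].
  have := ts (- slope j); rewrite (bigD1 j) //= addNr eqxx; have := M0 j; lia.
apply/negP => /eqP sij; have := ts (- slope j).
rewrite (bigD1 j) //= (bigD1 i) //= sij addNr eqxx; have := M0 j; have := M0 i; lia.
Qed.

Lemma ordinary_case f : ordinary_multiple_point p -> real_bound M L q f ->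
  in_ideal M L q f.
Proof.
move=> [n [pn [a [b [homE nprop]]]]] fb.
have [M1 sl] := ordinary_simple_branches pn homE nprop.
have div i j : exists w, q i - q j = w * 'X^1.
  apply: low_coef0_dvd => -[|] // _.
  by rewrite coefB -!horner_coef0 !q0 subrr.
pose v i j := projT1 (boolp.cid (div i j)).
have vP i j : q i - q j = v i j * 'X^1 := projT2 (boolp.cid (div i j)).
apply: (@separated_case _ _ M L q f v (fun _ _ => 1%N)) => // i j ij.
split; [exact: vP| |exact: cutoff_ge1].
(* The value v(0) is the difference of the two slopes. *)
have := congr1 (fun g : {poly R} => g`_1) (vP i j).
by rewrite coefMXn /= -horner_coef0 => <-; rewrite coefB subr_eq0 sl.
Qed.

Lemma repeated_segments_case f : repeated_segments q -> real_bound M L q f ->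
  in_ideal M L q f.
Proof.
move=> qq fb; have [j0 _|noj] := pickP 'I_k.
  apply: (@repeated_case _ _ M L q f (q j0)) => // j.
  by exists 0; rewrite mul0r addr0; exact: qq.
(* Without branches there is no segment to choose, and 0 serves as q0. *)
by apply: (@repeated_case _ _ M L q f 0) => // [|j]; [rewrite horner0|have := noj j].
Qed.

End OrderAndTangents.

Lemma valuation0 (F : fieldType) (g : {poly F}) : g != 0 ->
  exists v r, g = v * 'X^r /\ v.[0] != 0.
Proof.
move=> g0; have [r [v vE gE]] := multiplicity_XsubC g 0.
by exists v, r; rewrite polyC0 subr0 in gE; rewrite (implyP vE).
Qed.

Section DoublePoint.
Variables (R : realType) (p : {poly {poly R[i]}}).
Variables (k : nat) (M L : 'I_k -> nat) (q : 'I_k -> {poly R}).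
Variable psi : 'I_k -> fps R[i].
Hypothesis hdata : puiseux_data p M L q psi.

(* If the contact order r exceeds a cutoff 2 L, then q i and q j agree modulo
   'X^(2 L), and one segment may replace the other in that factor. *)
Lemma two_branches_case f (i j : 'I_k) : (forall l, M l = 1%N) -> i != j ->
  (forall l, (l == i) || (l == j)) -> real_bound M L q f -> in_ideal M L q f.
Proof.
move=> M1 ij cover fb; have q0 := puiseux_q0 hdata.
have [qij|] := eqVneq (q i) (q j).
  apply: (repeated_segments_case hdata) => // l l'.
  by case/orP: (cover l) => /eqP ->; case/orP: (cover l') => /eqP ->.
rewrite -subr_eq0 => /valuation0[v [r [qE v0]]].
have [ri|ir] := leqP r (2 * L i); last first.
  apply: (@repeated_case _ _ M L q f (q j)) => // l.
  case/orP: (cover l) => /eqP ->; last by exists 0; rewrite mul0r addr0.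
  exists (v * 'X^(r - 2 * L i)).
  by rewrite -mulrA -exprD subnK 1?ltnW // -qE addrC subrK.
have [rj|jr] := leqP r (2 * L j); last first.
  apply: (@repeated_case _ _ M L q f (q i)) => // l.
  case/orP: (cover l) => /eqP ->; first by exists 0; rewrite mul0r addr0.
  exists (- v * 'X^(r - 2 * L j)).
  by rewrite -mulrA -exprD subnK 1?ltnW // mulNr -qE opprB addrC subrK.
apply: (@separated_case _ _ M L q f (fun l _ => if l == i then v else - v) (fun _ _ => r)).
- exact: M1.
- exact: q0.
- move=> l l' ll'.
  case/orP: (cover l) => /eqP lE; case/orP: (cover l') => /eqP lE'.
  + by rewrite lE lE' eqxx in ll'.
  + by rewrite lE lE' eqxx; split.
  + rewrite lE lE' eq_sym (negbTE ij); split=> //.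
      by rewrite mulNr -qE opprB.
    by rewrite hornerN oppr_eq0.
  + by rewrite lE lE' eqxx in ll'.
- exact: fb.
Qed.

(** Order 2 means sum_j M j = 2: there are two branches of degree 1, or a single branch of degree 2,
    whose segment is trivially repeated. *)
Lemma double_case f : double_point p -> real_bound M L q f -> in_ideal M L q f.
Proof.
move=> /(order_sum hdata) sM fb; have M0 := puiseux_M_gt0 hdata.
have kM : (k <= \sum_j M j)%N.
  by rewrite -[leqLHS]card_ord -sum1_card; apply: leq_sum => j _; exact: M0.
have [M1|[j Mj]] : (forall j, M j = 1%N) \/ exists j, (1 < M j)%N.
  have [/forallP H|] := boolP [forall j, (M j == 1)%N].
    by left=> j; apply/eqP.
  rewrite negb_forall => /existsP[j Mj]; right; exists j.
  by have := M0 j; case: (M j) Mj => [|[]].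
- move: sM; rewrite (eq_bigr (fun=> 1%N)) // sum1_card card_ord => k2.
  have lt0 : (0 < k)%N by rewrite -k2.
  have lt1 : (1 < k)%N by rewrite -k2.
  apply: (two_branches_case (i := Ordinal lt0) (j := Ordinal lt1)) => // l.
  by rewrite -!val_eqE /=; case: l => -[|[|l]] //=; rewrite -k2.
- apply: (repeated_segments_case hdata) => // i i'.
  have all_j l : l = j.
    apply/eqP/negPn/negP => lj; move: sM.
    by rewrite (bigD1 j) //= (bigD1 l) //=; have := M0 l; lia.
  by rewrite (all_j i) (all_j i').
Qed.

End DoublePoint.

Theorem theorem1p2 (R : realType) (p : {poly {poly R[i]}})
    (k : nat) (M L : 'I_k -> nat) (q : 'I_k -> {poly R})
    (psi : 'I_k -> fps R[i])
    (hp : pure_stable p) (hp0 : peval p (0, 0) = 0)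
    (hdata : puiseux_data p M L q psi)
    (f : {poly {poly R[i]}}) :
  [/\ product_ideal M L q (R0_of_poly f) ->
        locally_Hinf (fun z => peval f z / peval p z),
      locally_Hinf (fun z => peval f z / peval p z) <->
        locally_Hinf (fun z => peval f z / peval (bracket M L q) z) &
      double_point p \/ ordinary_multiple_point p \/ repeated_segments q ->
        locally_Hinf (fun z => peval f z / peval p z) ->
        product_ideal M L q (R0_of_poly f)].
Proof.
have [pb bp] := dom_p_bracket hdata.
have b0 := bracket_neq0 hdata.
have p0 : nearO (fun z => H2 z -> peval p z != 0).
  by exists 1 => // z _ _ hz; apply/eqP; exact: hp.1.
split.
- move=> /(dom_product_ideal hdata) fb; apply: Hinf_of_dom p0.
  apply: dom_trans bp; apply: dom_trans fb; apply: dom_eq.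
  by exists 1 => // z _ _; rewrite eval2_poly.
- split=> H.
    by apply: Hinf_of_dom b0; apply: dom_trans pb; exact: dom_of_Hinf p0.
  by apply: Hinf_of_dom p0; apply: dom_trans bp; exact: dom_of_Hinf b0.
- move=> cases H; have fb : real_bound M L q f.
    apply: real_bound_of_dom; apply: dom_trans pb; exact: dom_of_Hinf p0.
  case: cases => [dp|[op|rs]].
  + exact: double_case hdata _ dp fb.
  + exact: ordinary_case hdata _ op fb.
  + exact: repeated_segments_case hdata _ rs fb.
Qed.
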